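(* Let $\mathbb{G}$ be a Green kernel of type $(s,\gamma)$ on $\Omega$ with Green operator $\mathcal{G}$, and let $\beta\in\mathbb{R}$ satisfy $\beta+\gamma>-1$. Then $\delta^\beta\in L^1(\Omega,\delta^\gamma)$ and, in $\Omega$, $$\mathcal{G}(\delta^\beta)\asymp\begin{cases}\delta^{\beta+2s} & \text{if }\beta<\gamma-2s,\\ \delta^{\gamma}\,(1+|\ln\delta|) & \text{if }\beta=\gamma-2s,\\ \delta^{\gamma} & \text{if }\beta>\gamma-2s.\end{cases}$$ (The first two cases can occur only if $\gamma>s-\frac12$; when $\gamma\le s-\frac12$ the condition $\beta+\gamma>-1$ excludes them, so that then $\mathcal{G}(\delta^\beta)\asymp\delta^\gamma$.)
   Context: $\Omega\subset\mathbb{R}^n$ ($n\ge1$) is a bounded domain with $C^{1,1}$ boundary and $\delta(x)=\mathrm{dist}(x,\partial\Omega)$. Write $a\wedge b=\min\{a,b\}$. For nonnegative functions, $f\asymp g$ on a set means that there is a constant $C>0$ with $C^{-1}g\le f\le Cg$ on that set. $L^1(\Omega,\delta^\gamma)$ is the set of measurable $f$ on $\Omega$ with $f\delta^\gamma\in L^1(\Omega)$. A Green kernel of type $(s,\gamma)$ on $\Omega$, where $s,\gamma\in(0,1]$ and $2s\le n$, is a measurable function $\mathbb{G}:\Omega\times\Omega\to\mathbb{R}$ such that $\mathbb{G}(x,y)=\mathbb{G}(y,x)$ and $$\mathbb{G}(x,y)\asymp\frac{1}{|x-y|^{n-2s}}\Big(\frac{\delta(x)\delta(y)}{|x-y|^2}\wedge1\Big)^\gamma,\qquad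 x,y\in\Omega,\ x\ne y.$$ Its Green operator is $\mathcal{G}(f)(x)=\int_\Omega\mathbb{G}(x,y)f(y)\,dy$. *)

(* Defs.v *)
From HB Require Import structures.
From mathcomp Require Import all_boot all_order all_algebra.
From mathcomp Require Import all_classical all_reals all_analysis.

Set Implicit Arguments.
Unset Strict Implicit.
Unset Printing Implicit Defensive.

Import Order.TTheory GRing.Theory Num.Theory.
Import numFieldNormedType.Exports.

Local Open Scope classical_set_scope.
Local Open Scope ring_scope.

(* 'rV[R]_n carries the sigma-algebra generated by the coordinates, that is,
   the Borel sigma-algebra of R^n. *)

Definition rV_display : measure_display. Proof. exact. Qed.

Definition rV_coord_sets (R : realType) (n : nat) : set (set 'rV[R]_n) :=
  \bigcup_(i : 'I_n) preimage_set_system setT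
    (fun x : 'rV[R]_n => x 0 i : measurableTypeR R) measurable.

HB.instance Definition _ (R : realType) (n : nat) :=
  @isMeasurable.Build rV_display 'rV[R]_n <<s @rV_coord_sets R n >>
    (@sigma_algebra0 _ _ _) (@sigma_algebraC _ _)
    (@sigma_algebra_bigcup _ _ _).

Lemma measurable_coord (R : realType) (n : nat) (i : 'I_n) :
  measurable_fun setT (fun x : 'rV[R]_n => x 0 i : measurableTypeR R).
Proof.
move=> _ Y mY; rewrite setTI; apply: sub_sigma_algebra.
by exists i => //; exists Y => //; rewrite setTI.
Qed.

Lemma measurable_fun_coordP (d : measure_display) (T : measurableType d)
    (R : realType) (n : nat) (f : T -> 'rV[R]_n) :
  (forall i, measurable_fun setT (fun t => f t 0 i : measurableTypeR R)) ->
  measurable_fun setT f.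
Proof.
move=> mf; apply: (@measurability _ _ T 'rV[R]_n setT f (@rV_coord_sets R n)) => //.
move=> _ [_ [i _ [A mA <-]] <-].
by rewrite !setTI; have := mf i measurableT A mA; rewrite setTI.
Qed.

Definition consr (R : realType) (n : nat) (p : measurableTypeR R * 'rV[R]_n)
    : 'rV[R]_n.+1 :=
  \row_(i < n.+1) if unlift ord0 i is Some j then p.2 0 j else p.1.

Definition unconsr (R : realType) (n : nat) (x : 'rV[R]_n.+1)
    : measurableTypeR R * 'rV[R]_n :=
  (x 0 ord0, \row_(j < n) x 0 (lift ord0 j)).

Lemma consrK (R : realType) (n : nat) : cancel (@consr R n) (@unconsr R n).
Proof.
case=> a x; rewrite /unconsr !mxE unlift_none; congr pair.
by apply/rowP => j; rewrite !mxE liftK.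
Qed.

Lemma unconsrK (R : realType) (n : nat) : cancel (@unconsr R n) (@consr R n).
Proof. by move=> x; apply/rowP => i; rewrite !mxE; case: unliftP => [j|] ->; rewrite ?mxE. Qed.

Lemma measurable_consr (R : realType) (n : nat) :
  measurable_fun setT (@consr R n).
Proof.
apply: measurable_fun_coordP => i.
case: (unliftP ord0 i) => [j|] ->.
- rewrite (_ : (fun _ => _) = (fun x : 'rV[R]_n => x 0 j : measurableTypeR R) \o snd).
    exact: measurableT_comp (measurable_coord j) _.
  by apply/funext => p; rewrite mxE liftK.
- rewrite (_ : (fun _ => _) = fst); first exact: measurable_fst.
  by apply/funext => p; rewrite mxE unlift_none.
Qed.

Lemma measurable_unconsr (R : realType) (n : nat) :
  measurable_fun setT (@unconsr R n).
Proof.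
apply: measurable_fun_pair; first exact: measurable_coord.
apply: measurable_fun_coordP => j.
under eq_fun do rewrite mxE.
exact: measurable_coord.
Qed.

Section lebesgue_measure_step.
Context (R : realType) (n : nat).
Variable mu : {sigma_finite_measure set 'rV[R]_n -> \bar R}.

Definition leb_step : set 'rV[R]_n.+1 -> \bar R :=
  pushforward (lebesgue_measure \x mu)%E (@consr R n).

Let leb_step0 : leb_step set0 = 0%E.
Proof. by rewrite /leb_step /pushforward preimage_set0 measure0. Qed.

Let leb_step_ge0 A : (0 <= leb_step A)%E.
Proof. by apply: measure_ge0; exact: measurable_consr. Qed.

Let leb_step_sigma_additive : semi_sigma_additive leb_step.
Proof.
by apply: measure_semi_sigma_additive; exact: measurable_consr.
Qed.

HB.instance Definition _ := isMeasure.Build _ _ _ leb_step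
  leb_step0 leb_step_ge0 leb_step_sigma_additive.

Let leb_step_sigma_finite : sigma_finite setT leb_step.
Proof.
have /sigma_finiteP[F [TF ndF Foo]] := sigma_finiteT (@lebesgue_measure R).
have /sigma_finiteP[G [TG ndG Goo]] := sigma_finiteT mu.
exists (fun k => @unconsr R n @^-1` (F k `*` G k)).
  apply/seteqP; split => // x _.
  have [i _ Fi] : (\bigcup_k F k) (unconsr x).1 by rewrite -TF.
  have [j _ Gj] : (\bigcup_k G k) (unconsr x).2 by rewrite -TG.
  exists (maxn i j) => //; split.
    by move: Fi; exact/subsetPset/ndF/leq_maxl.
  by move: Gj; exact/subsetPset/ndG/leq_maxr.
move=> k; have [mF Fk] := Foo k; have [mG Gk] := Goo k.
have mFG : measurable (F k `*` G k) by exact: measurableX.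
split.
  by rewrite -[X in measurable X]setTI; exact: measurable_unconsr.
rewrite /leb_step /pushforward -comp_preimage.
rewrite (_ : _ \o _ = id); last by apply/funext; exact: consrK.
by rewrite preimage_id product_measure1E// lte_mul_pinfty// ge0_fin_numE.
Qed.

HB.instance Definition _ :=
  Measure_isSigmaFinite.Build _ _ _ leb_step leb_step_sigma_finite.

End lebesgue_measure_step.

Fixpoint lebesgue_rV (R : realType) (n : nat)
    : {sigma_finite_measure set 'rV[R]_n -> \bar R} :=
  match n with
  | 0%N => [the {sigma_finite_measure set 'rV[R]_0 -> \bar R} of \d_(0 : 'rV[R]_0)]
  | m.+1 => [the {sigma_finite_measure set 'rV[R]_m.+1 -> \bar R}
              of leb_step (lebesgue_rV R m)]
  end.

(* The normalization on boxes, which characterizes the Lebesgue measure. *)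
Lemma lebesgue_rV_box (R : realType) (n : nat) (a b : 'rV[R]_n) :
  (forall i, a 0 i <= b 0 i) ->
  lebesgue_rV R n [set x | forall i, x 0 i \in `[a 0 i, b 0 i]] =
    (\prod_(i < n) (b 0 i - a 0 i))%:E.
Proof.
elim: n a b => [|n IH] a b ab.
  by rewrite big_ord0 /= diracE mem_set // => -[].
pose a' := (unconsr a).2; pose b' := (unconsr b).2.
have ab' i : a' 0 i <= b' 0 i by rewrite !mxE.
have mB : measurable [set x : 'rV[R]_n | forall i, x 0 i \in `[a' 0 i, b' 0 i]].
  rewrite (_ : mkset _ = \bigcap_(i in [set` index_enum 'I_n])
      ((fun x : 'rV[R]_n => x 0 i : measurableTypeR R) @^-1` `[a' 0 i, b' 0 i]%classic)).
    rewrite bigcap_seq; apply: bigsetI_measurable => i _; rewrite -[X in measurable X]setTI.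
    by apply: measurable_coord => //; exact: measurable_itv.
  apply/seteqP; split => x /=; first by move=> h i _; exact: h.
  by move=> h i; apply: h; exact: mem_index_enum.
rewrite /= /leb_step /pushforward.
rewrite (_ : _ @^-1` _ = `[a 0 ord0, b 0 ord0]%classic `*`
    [set x : 'rV[R]_n | forall i, x 0 i \in `[a' 0 i, b' 0 i]]).
  rewrite product_measure1E //.
  rewrite [X in (_ * X)%E](IH _ _ ab').
  rewrite [X in (X * _)%E](_ : _ = lebesgue_measure `[a 0 ord0, b 0 ord0]%classic) //.
  rewrite lebesgue_measure_itv /= lte_fin.
  rewrite big_ord_recl; under eq_bigr do rewrite !mxE.
  rewrite EFinM; congr (_ * _)%E.
  have := ab ord0; rewrite le_eqVlt => /predU1P[->|->]; last by rewrite EFinB.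
  by rewrite ltxx subrr.
apply/seteqP; split => -[t y] /=.
  move=> h; split; first by have := h ord0; rewrite mxE unlift_none.
  by move=> i; have := h (lift ord0 i); rewrite !mxE liftK.
move=> [ht hy] i; case: (unliftP ord0 i) => [j|] ->; rewrite mxE.
  by rewrite liftK; have := hy j; rewrite !mxE.
by rewrite unlift_none.
Qed.

Section euclidean_geometry.
Context (R : realType) (n : nat).
Implicit Types (A : set 'rV[R]_n) (x : 'rV[R]_n).

(* The norm `|x| of the library on 'rV[R]_n is the sup norm. *)
Definition enorm x : R := Num.sqrt (\sum_(i < n) x 0 i ^+ 2).

Definition boundary A : set 'rV[R]_n := closure A `\` A^°.

Definition bdist A x : R := inf [set enorm (x - y) | y in boundary A].

Definition C11 (phi : 'rV[R]_n -> R) : Prop :=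
  (forall z, differentiable phi z) /\
  exists L : R, forall z w v,
    `|'d phi z v - 'd phi w v| <= L * enorm (z - w) * enorm v.

End euclidean_geometry.

(* Near each boundary point, after the rigid motion y = (x - p) *m Q, the set is
   the strict epigraph { y_n > phi (y_1, ..., y_(n-1)) } of a C^{1,1} function,
   where n = d.+1. *)
Definition C11_boundary (R : realType) (d : nat) (Omega : set 'rV[R]_d.+1) : Prop :=
  forall p, boundary Omega p ->
  exists (r : R) (Q : 'M[R]_d.+1) (phi : 'rV[R]_d -> R),
  [/\ 0 < r, Q *m Q^T = 1%:M, C11 phi &
    forall x, enorm (x - p) < r ->
      let y := (x - p) *m Q in
      Omega x <-> phi (col' ord_max y) < y 0 ord_max].

Definition bounded_C11_domain (R : realType) (d : nat) (Omega : set 'rV[R]_d.+1)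
    : Prop :=
  [/\ Omega !=set0, open Omega, connected Omega, bounded_set Omega &
    C11_boundary Omega].

(* Measurability with respect to the completion of mu; the library's
   measurable_fun is Borel measurability. *)
Definition completion_measurable (d : measure_display) (T : measurableType d)
    (R : realType) (mu : set T -> \bar R) (A : set T) : Prop :=
  exists2 B, measurable B & mu.-negligible ((A `\` B) `|` (B `\` A)).

Definition completion_measurable_fun (d : measure_display) (T : measurableType d)
    (R : realType) (mu : set T -> \bar R) (D : set T) (f : T -> R) : Prop :=
  forall Y : set (measurableTypeR R), measurable Y ->
    completion_measurable mu (D `&` f @^-1` Y).

Definition asymp (T : Type) (R : realType) (D : set T) (f g : T -> \bar R) : Prop :=
  exists2 C : R, 0 < C &
    forall x, D x -> (C^-1%:E * g x <= f x)%E /\ (f x <= C%:E * g x)%E.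

Section green_kernels.
Context (R : realType) (d : nat).
Implicit Types (Omega : set 'rV[R]_d.+1) (G : 'rV[R]_d.+1 -> 'rV[R]_d.+1 -> R).

Local Notation leb := (lebesgue_rV R d.+1).
Local Notation dim := (d.+1%:R : R).

Definition weighted_L1 Omega (gamma : R) (f : 'rV[R]_d.+1 -> R) : Prop :=
  completion_measurable_fun leb Omega f /\
  (\int[leb]_(x in Omega) `|f x * bdist Omega x `^ gamma|%:E < +oo)%E.

Definition green_bound Omega (s gamma : R) (x y : 'rV[R]_d.+1) : R :=
  (enorm (x - y) `^ (dim - 2 * s))^-1 *
  Num.min (bdist Omega x * bdist Omega y / enorm (x - y) ^+ 2) 1 `^ gamma.

(* Only the values of G on Omega x Omega matter. *)
Definition green_kernel Omega (s gamma : R) G : Prop :=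
  [/\ 0 < s <= 1, 0 < gamma <= 1, 2 * s <= dim,
      completion_measurable_fun (leb \x leb)%E (Omega `*` Omega)
        (fun p => G p.1 p.2) &
      (forall x y, Omega x -> Omega y -> G x y = G y x) /\
      asymp [set p | [/\ Omega p.1, Omega p.2 & p.1 != p.2]]
        (fun p => (G p.1 p.2)%:E) (fun p => (green_bound Omega s gamma p.1 p.2)%:E)].

(* Extended-real valued: finiteness of the integral is part of the estimates.
   For exceptional x (a null set) the section G x need not be measurable; the
   integral is then the supremum over the simple functions below the integrand
   (for the positive and the negative part), as in the library. *)
Definition green_operator Omega G (f : 'rV[R]_d.+1 -> R) (x : 'rV[R]_d.+1) : \bar R :=
  (\int[leb]_(y in Omega) (G x y * f y)%:E)%E.

End green_kernels.

(* Main.v *)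
Require Import Defs.
From HB Require Import structures.
From mathcomp Require Import all_boot all_order all_algebra.
From mathcomp Require Import all_classical all_reals all_analysis.
From mathcomp Require Import measurable_realfun.
From mathcomp Require Import ring lra.

(* Up to constants, G(x, y) delta(y)^beta is an explicit kernel, with r = delta(x).

   Upper bound. On the ball |x - y| < r/2 one has delta(y) ~ r, and the kernel
   integrates to r^(beta + 2s). On the shell |x - y| ~ t, t = 2^k r, the kernel is
   at most t^(2s - n - 2 gamma) r^gamma delta(y)^(beta + gamma). Boundary layers
   satisfy |{y in Omega : |x - y| < t, delta(y) < e}| <= C e t^(n-1), so that
   delta^(beta + gamma) integrates over the ball of radius t to at most
   C t^(n + beta + gamma), because beta + gamma > -1. The shell thus contributes
   r^gamma t^(beta + 2s - gamma), and the three cases are those of the sum of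
   (2^k r)^(beta + 2s - gamma) over 2^k r <= diam Omega.

   Lower bound. A fixed ball inside Omega gives r^gamma and the ball |x - y| < r/2
   gives r^(beta + 2s). In the critical case every scale t = 4^k r contributes
   r^gamma through a ball of radius ~ t at distance ~ t from the boundary, obtained
   by moving x along the vertical direction of a boundary chart; there are about
   |ln r| such scales, and the balls are disjoint.

   The layer estimate uses only that Omega is locally a Lipschitz epigraph: the
   translates of a layer in the vertical direction of the chart are disjoint. *)

Import Order.TTheory GRing.Theory Num.Theory.
Import numFieldNormedType.Exports.

Set Implicit Arguments.
Unset Strict Implicit.
Unset Printing Implicit Defensive.

Local Open Scope classical_set_scope.
Local Open Scope ring_scope.

(** * Monotonicity of the integral without measurability *)

Section nonmeasurable_integrals.
Context (d : measure_display) (T : measurableType d) (R : realType).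
Variable mu : {measure set T -> \bar R}.
Implicit Types (D S : set T).

Import HBNNSimple.

(* No measurability: the integral of a nonnegative function is the supremum over
   the simple functions below it. *)
Lemma ge0_le_integral_lower D (f g : T -> \bar R) :
  (forall x, D x -> (0 <= f x)%E) -> (forall x, D x -> (f x <= g x)%E) ->
  (\int[mu]_(x in D) f x <= \int[mu]_(x in D) g x)%E.
Proof.
move=> f0 fg; rewrite !ge0_integralE//; last first.
  by move=> x Dx; rewrite (le_trans _ (fg _ Dx)) ?f0.
apply: ereal_sup_le => _ [h hf <-].
exists h => // x; apply: (le_trans (hf x)); rewrite /patch.
by case: ifPn => // /set_mem; exact: fg.
Qed.

End nonmeasurable_integrals.

(** * Lebesgue measure on R^n *)

Section lebesgue_rV.
Context (R : realType).

(** Lebesgue measure is determined by its values on half-open intervals, and its image under the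
    shift takes the same values there. *)
Lemma lebesgue_measure_shift (v : R) (A : set (measurableTypeR R)) : measurable A ->
  lebesgue_measure ((fun x => x + v : measurableTypeR R) @^-1` A) = lebesgue_measure A.
Proof.
move=> mA.
have mS : measurable_fun setT (fun x : measurableTypeR R => x + v : measurableTypeR R).
  exact: measurable_funD.
pose S : {mfun measurableTypeR R >-> measurableTypeR R} :=
  HB.pack (fun x : measurableTypeR R => x + v : measurableTypeR R)
    (isMeasurableFun.Build _ _ _ _ _ mS).
apply: esym; rewrite [LHS](@lebesgue_measure_unique _ (pushforward lebesgue_measure S))//.
move=> _ [[a b] _ <-] /=; rewrite /pushforward/=.
rewrite (_ : _ @^-1` _ = `]a - v, b - v]%classic); last first.
  by apply/seteqP; split => x /=; rewrite !in_itv/= ltrBlDr lerBrDr.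
by rewrite !lebesgue_measure_itv/= !lte_fin ltrD2r -!EFinD opprD addrACA subrr addr0.
Qed.

Lemma measurable_rV_shift (n : nat) (v : 'rV[R]_n) :
  measurable_fun setT (fun x : 'rV[R]_n => x + v).
Proof.
apply: measurable_fun_coordP => i; under eq_fun do rewrite mxE.
by apply: measurable_funD => //; exact: measurable_coord.
Qed.

(** Induction on the dimension: through [consr] a shift acts separately on the first coordinate and
    on the others, so uniqueness of the product measure leaves only rectangles to check. In
    dimension 0 there is a single point. *)
Lemma lebesgue_rV_shift (n : nat) (v : 'rV[R]_n) (A : set 'rV[R]_n) : measurable A ->
  lebesgue_rV R n ((fun x => x + v) @^-1` A) = lebesgue_rV R n A.
Proof.
elim: n v A => [|n IH] v A mA.
  congr (lebesgue_rV R 0 _); apply/seteqP; split => x /=;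
    by rewrite (thinmx0 (x + v)) (thinmx0 x).
pose S2 (p : measurableTypeR R * 'rV[R]_n) : measurableTypeR R * 'rV[R]_n :=
  (p.1 + v 0 ord0, p.2 + (unconsr v).2).
have mS2 : measurable_fun setT S2.
  apply: measurable_fun_pair.
    by apply: measurable_funD => //; exact: measurable_fst.
  apply: measurable_fun_coordP => i; under eq_fun do rewrite mxE.
  apply: measurable_funD => //.
  rewrite (_ : (fun _ => _) = (fun x : 'rV[R]_n => x 0 i : measurableTypeR R) \o snd)//.
  exact: measurableT_comp (measurable_coord i) _.
have S2E p : consr p + v = consr (S2 p).
  apply/rowP => i; rewrite !mxE.
  by case: (unliftP ord0 i) => [j|] -> /=; rewrite ?liftK ?unlift_none ?mxE.
pose S : {mfun (measurableTypeR R * 'rV[R]_n)%type >-> (measurableTypeR R * 'rV[R]_n)%type} :=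
  HB.pack S2 (isMeasurableFun.Build _ _ _ _ _ mS2).
rewrite /= /leb_step /pushforward.
rewrite (_ : _ @^-1` _ = S2 @^-1` (@consr R n @^-1` A)); last first.
  by apply/seteqP; split => p /=; rewrite S2E.
rewrite [RHS](@product_measure_unique _ _ _ _ _ _ _
    (pushforward (lebesgue_measure \x lebesgue_rV R n)%E S))//.
  move=> B1 B2 mB1 mB2; rewrite /pushforward/=.
  transitivity ((lebesgue_measure \x lebesgue_rV R n)%E
    (((fun x => x + v 0 ord0 : measurableTypeR R) @^-1` B1) `*`
     ((fun x => x + (unconsr v).2) @^-1` B2))) => //.
  have mB1' : measurable
      ((fun x : measurableTypeR R => x + v 0 ord0 : measurableTypeR R) @^-1` B1).
    rewrite -[X in measurable X]setTI.
    have : measurable_fun setT (fun x : measurableTypeR R => x + v 0 ord0 : measurableTypeR R).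
      exact: measurable_funD.
    exact.
  have mB2' : measurable ((fun x => x + (unconsr v).2) @^-1` B2).
    rewrite -[X in measurable X]setTI; exact: measurable_rV_shift.
  rewrite product_measure1E//; congr (_ * _)%E; last exact: IH.
  exact: lebesgue_measure_shift.
by rewrite -[X in measurable X]setTI; exact: measurable_consr.
Qed.

(** The sigma-algebra is generated by the coordinates, so [U] is written as the countable union of
    the boxes with rational centre and radius 1/(k+1) that it contains. *)
Lemma open_rV_measurable (n : nat) (U : set 'rV[R]_n) : open U -> measurable U.
Proof.
move=> oU.
pose box (p : 'rV[rat]_n * nat) := [set y : 'rV[R]_n | forall i,
  `|y 0 i - ratr (p.1 0 i)| < p.2.+1%:R^-1].
have mbox p : measurable (box p).
  rewrite (_ : box p = \bigcap_(i in [set` index_enum 'I_n])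
      ((fun x : 'rV[R]_n => x 0 i : measurableTypeR R) @^-1`
         ball (ratr (p.1 0 i) : R) (p.2.+1%:R^-1 : R))).
    rewrite bigcap_seq; apply: bigsetI_measurable => i _.
    rewrite -[X in measurable X]setTI.
    by apply: measurable_coord => //; exact: measurable_ball.
  apply/seteqP; split => y /= h i; first by rewrite /ball/= distrC.
  by rewrite distrC; apply: h; exact: mem_index_enum.
rewrite (_ : U = \bigcup_(p in setT) (if `[< box p `<=` U >] then box p else set0)).
  apply: countable_bigcupT_measurable; first exact: countableP.
  by move=> p; case: ifP.
apply/seteqP; split => [x Ux|x [p _]]; last by case: asboolP => // + /= => /[apply].
have /nbhs_ballP[e /= e0 eU] : nbhs x U by apply: open_nbhs_nbhs.
(* With 2/(k+1) < e, a box of radius 1/(k+1) whose centre is 1/(k+1)-close to x stays in the ball of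
   radius e around x. *)
pose k := Num.truncn (2 / e).
have ke : 2 / k.+1%:R < e.
  rewrite ltr_pdivrMr// mulrC -ltr_pdivrMr//.
  exact: truncnS_gt.
have q_ i : exists q : rat, `|x 0 i - ratr q| < k.+1%:R^-1.
  have [|q] := @rat_in_itvoo _ (x 0 i - k.+1%:R^-1) (x 0 i + k.+1%:R^-1).
    by rewrite ltrBlDr -addrA ltrDl addr_gt0.
  rewrite in_itv/= => /andP[q1 q2]; exists q.
  by rewrite distrC ltr_distl q1.
have [q qP] := choice q_.
exists (\row_i q i, k) => //=; case: asboolP => [_ i|]; first by rewrite mxE.
case=> y /= yb; apply: eU; split=> // i j.
rewrite ord1 /ball/=; have := yb j; have := qP j; rewrite mxE => h1 h2.
rewrite (le_lt_trans (ler_distD (ratr (q j)) _ _))//.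
apply: lt_trans ke; rewrite mulr_natl mulr2n ltrD//.
by rewrite distrC.
Qed.

Lemma continuous_rV_measurable (n : nat) (f : 'rV[R]_n -> R) : continuous f ->
  measurable_fun setT (f : 'rV[R]_n -> measurableTypeR R).
Proof.
move=> /continuousP cf; apply: (measurability _ (RGenOpens.measurableE R)).
move=> _ [_ [a [b ->] <-]]; rewrite setTI; apply: open_rV_measurable.
exact/cf/interval_open.
Qed.

End lebesgue_rV.

(** * The Euclidean norm, compared with the sup norm *)

Section enorm_theory.
Context (R : realType) (n : nat).
Implicit Types (x y z : 'rV[R]_n).

Lemma enorm_ge0 x : 0 <= enorm x.
Proof. exact: sqrtr_ge0. Qed.

Lemma enorm_sqr x : enorm x ^+ 2 = \sum_(i < n) x 0 i ^+ 2.
Proof. by rewrite sqr_sqrtr// sumr_ge0// => i _; rewrite sqr_ge0. Qed.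

Lemma enorm0 : enorm (0 : 'rV[R]_n) = 0.
Proof. by rewrite /enorm big1 ?sqrtr0// => i _; rewrite mxE expr0n. Qed.

Lemma enormZ (k : R) x : enorm (k *: x) = `|k| * enorm x.
Proof.
rewrite /enorm -sqrtr_sqr -sqrtrM ?sqr_ge0// mulr_sumr.
by congr Num.sqrt; apply: eq_bigr => i _; rewrite mxE exprMn.
Qed.

Lemma enormN x : enorm (- x) = enorm x.
Proof. by rewrite -scaleN1r enormZ normrN normr1 mul1r. Qed.

Lemma enormBC x y : enorm (x - y) = enorm (y - x).
Proof. by rewrite -enormN opprB. Qed.

Lemma coord_le_enorm x i : `|x 0 i| <= enorm x.
Proof.
rewrite -sqrtr_sqr ler_wsqrtr// (bigD1 i)//= lerDl sumr_ge0// => j _.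
exact: sqr_ge0.
Qed.

Lemma norm_le_enorm x : `|x| <= enorm x.
Proof.
rewrite [leLHS]mx_normrE; apply/bigmax_leP; split; first exact: enorm_ge0.
by move=> [i j] _ /=; rewrite ord1 coord_le_enorm.
Qed.

Lemma coord_le_norm x i : `|x 0 i| <= `|x|.
Proof. by rewrite [leRHS]mx_normrE (le_bigmax _ (fun ij => `|x ij.1 ij.2|) (0, i)). Qed.

Lemma enorm_eq0 x : (enorm x == 0) = (x == 0).
Proof.
apply/idP/eqP => [/eqP x0|->]; last by rewrite enorm0.
by apply/eqP; rewrite -normr_le0 -x0 norm_le_enorm.
Qed.

(** Summing (|y| x_i - |x| y_i)^2 >= 0 gives the inequality multiplied by 2 |x| |y|; zero vectors,
    for which that factor vanishes, are treated first. *)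
Lemma enorm_cauchy x y : \sum_(i < n) x 0 i * y 0 i <= enorm x * enorm y.
Proof.
have [->|x0] := eqVneq x 0.
  by rewrite enorm0 mul0r big1// => i _; rewrite mxE mul0r.
have [->|y0] := eqVneq y 0.
  by rewrite enorm0 mulr0 big1// => i _; rewrite mxE mulr0.
have ab0 : 0 < 2 * (enorm x * enorm y).
  by rewrite !mulr_gt0// lt_def enorm_ge0 enorm_eq0 ?x0 ?y0.
rewrite -(ler_pM2l ab0) mulr_sumr.
apply: (@le_trans _ _ (\sum_(i < n)
    (enorm y ^+ 2 * x 0 i ^+ 2 + enorm x ^+ 2 * y 0 i ^+ 2))).
  apply: ler_sum => i _; rewrite -subr_ge0.
  by rewrite (_ : _ - _ = (enorm y * x 0 i - enorm x * y 0 i) ^+ 2) ?sqr_ge0//; ring.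
rewrite big_split/= -!mulr_sumr -!enorm_sqr le_eqVlt; apply/orP; left; apply/eqP; ring.
Qed.

Lemma enormD x y : enorm (x + y) <= enorm x + enorm y.
Proof.
rewrite -(ler_pXn2r (n := 2))// ?nnegrE ?addr_ge0 ?enorm_ge0//.
rewrite enorm_sqr.
under eq_bigr do rewrite mxE sqrrD.
rewrite !big_split/= -!enorm_sqr sqrrD lerD2r lerD2l -mulr2n lerMn2r/=.
exact: enorm_cauchy.
Qed.

Lemma enorm_triangle x y z : enorm (x - z) <= enorm (x - y) + enorm (y - z).
Proof. by rewrite -[X in enorm X](subrKA y) enormD. Qed.

Lemma enorm_le_norm x : enorm x <= n%:R * `|x|.
Proof.
rewrite -(ler_pXn2r (n := 2))// ?nnegrE ?enorm_ge0 ?mulr_ge0// enorm_sqr.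
apply: (@le_trans _ _ (\sum_(i < n) `|x| ^+ 2)).
  apply: ler_sum => i _; rewrite -(real_normK (num_real (x 0 i))).
  by rewrite ler_pXn2r// ?nnegrE// coord_le_norm.
rewrite sumr_const card_ord exprMn -[leLHS]mulr_natl ler_wpM2r ?sqr_ge0//.
by rewrite -natrX ler_nat; case: (n) => // m; rewrite leq_pmulr.
Qed.

(** The topology is that of the sup norm, so the Euclidean bound passes through [enorm_le_norm].
    Exchanging the two points makes the one-sided bound two-sided. *)
Lemma lip_continuous (f : 'rV[R]_n -> R) (K : R) :
  (forall x y, f x <= f y + K * enorm (x - y)) -> continuous f.
Proof.
move=> fK x; apply/(@cvgrPdist_lt _ _ _ (nbhs x) (nbhs_filter x)) => e e0.
have K0 : 0 < `|K| * n%:R + 1 by rewrite ltr_wpDl// mulr_ge0.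
have e'0 : 0 < e / (`|K| * n%:R + 1) by rewrite divr_gt0.
near=> y.
have : `|x - y| < e / (`|K| * n%:R + 1).
  by near: y; apply: cvgr_dist_lt.
rewrite ltr_pdivlMr//; apply: le_lt_trans.
have fxy : `|f x - f y| <= `|K| * enorm (x - y).
  have h a b : f a - f b <= `|K| * enorm (a - b).
    rewrite lerBlDl (le_trans (fK a b))// lerD2l ler_wpM2r ?enorm_ge0//.
    exact: ler_norm.
  by rewrite ler_norml h andbT lerNl opprB enormBC h.
apply: (le_trans fxy); rewrite mulrDr mulr1; apply: ler_wpDr => //.
by rewrite mulrCA ler_wpM2l// mulrC enorm_le_norm.
Unshelve. all: by end_near. Qed.

Lemma enorm_sub_continuous y : continuous (fun x => enorm (x - y)).
Proof.
by apply: (@lip_continuous _ 1) => a b; rewrite mul1r [leRHS]addrC enorm_triangle.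
Qed.

Definition eball x (t : R) := [set y | enorm (x - y) < t].

Lemma open_eball x t : open (eball x t).
Proof.
rewrite (_ : eball x t = (fun y => enorm (y - x)) @^-1` `]-oo, t[%classic); last first.
  by apply/seteqP; split => y; rewrite /eball/= in_itv/= enormBC.
apply: open_comp; last exact: interval_open.
by move=> y _; exact: enorm_sub_continuous.
Qed.

Lemma eball_subset x y s t : enorm (x - y) + s <= t -> eball y s `<=` eball x t.
Proof.
move=> h z; rewrite /eball/= => yz; apply: lt_le_trans h.
by rewrite (le_lt_trans (enorm_triangle _ y _))// ltrD2l.
Qed.

End enorm_theory.

#[global] Hint Extern 0 (is_true (0 <= enorm _)) => solve [exact: enorm_ge0] : core.

(** * Measure of Euclidean balls *)

Section eball_measure.
Context (R : realType) (d : nat).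
Local Notation leb := (lebesgue_rV R d.+1).
Implicit Types (x : 'rV[R]_d.+1) (t : R).

Lemma measurable_eball x t : measurable (eball x t).
Proof. by apply: open_rV_measurable; exact: open_eball. Qed.

Let box x (t : R) := [set y : 'rV[R]_d.+1 |
  forall i, y 0 i \in `[(x - const_mx t) 0 i, (x + const_mx t) 0 i]].

Let measurable_box x t : measurable (box x t).
Proof.
rewrite (_ : box x t = \bigcap_(i in [set` index_enum 'I_d.+1])
    ((fun y : 'rV[R]_d.+1 => y 0 i : measurableTypeR R) @^-1`
        `[(x - const_mx t) 0 i, (x + const_mx t) 0 i]%classic)).
  rewrite bigcap_seq; apply: bigsetI_measurable => i _.
  rewrite -[X in measurable X]setTI.
  by apply: measurable_coord => //; exact: measurable_itv.
apply/seteqP; split => y /= h i; first by move=> _; exact: h.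
by apply: h; exact: mem_index_enum.
Qed.

Let box_measure x t : 0 <= t -> leb (box x t) = ((2 * t) ^+ d.+1)%:E.
Proof.
move=> t0; rewrite [LHS]lebesgue_rV_box; last first.
  by move=> i; rewrite !mxE lerD2l (le_trans _ t0)// oppr_le0.
congr EFin; rewrite -[in RHS](card_ord d.+1) -prodr_const; apply: eq_bigr => i _.
rewrite !mxE; ring.
Qed.

Lemma eball_measure_le x t : 0 <= t -> (leb (eball x t) <= ((2 * t) ^+ d.+1)%:E)%E.
Proof.
move=> t0; rewrite -(box_measure x t0); apply: le_measure; rewrite ?inE.
- exact: measurable_eball.
- exact: measurable_box.
- move=> y; rewrite /eball/= => xyt i; rewrite in_itv/= !mxE.
  rewrite -ler_distlC (le_trans _ (ltW xyt))//.
  by have := coord_le_enorm (x - y) i; rewrite !mxE.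
Qed.

(** With n = [d.+1], the cube of half-side t/(2n) about [x] lies in the open ball, because the
    Euclidean norm is at most n times the sup norm. *)
Lemma eball_measure_ge x t : 0 < t -> (((t / d.+1%:R) ^+ d.+1)%:E <= leb (eball x t))%E.
Proof.
move=> t0; have u0 : 0 <= t / d.+1%:R / 2 by rewrite !divr_ge0// ltW.
rewrite (_ : t / d.+1%:R = 2 * (t / d.+1%:R / 2)); last by rewrite mulrCA divff ?mulr1.
rewrite -(box_measure x u0); apply: le_measure; rewrite ?inE.
- exact: measurable_box.
- exact: measurable_eball.
- move=> y yb; rewrite /eball/=; apply: (le_lt_trans (enorm_le_norm _)).
  rewrite -ltr_pdivlMl//; apply: (@le_lt_trans _ _ (t / d.+1%:R / 2)).
    rewrite [leLHS]mx_normrE; apply/bigmax_leP; split => //= -[i j] _ /=.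
    by rewrite ord1 !mxE ler_distlC; have := yb j; rewrite in_itv/= !mxE.
  by rewrite [ltRHS]mulrC ltr_pdivrMr// ltr_pMr ?divr_gt0// ltr1n.
Qed.

Lemma rV_set1_measurable x : measurable [set x].
Proof.
rewrite (_ : [set x] = box x 0); first exact: measurable_box.
apply/seteqP; split => [y -> i|y yb]; rewrite /= ?in_itv/= ?mxE ?addr0 ?subr0 ?lexx//.
apply/rowP => i; have := yb i; rewrite in_itv/= !mxE addr0 subr0 => h.
by apply/eqP; rewrite eq_le andbC.
Qed.

(** Serves to discard the pole y = x, where a Green kernel is subject to no bound. *)
Lemma lebesgue_rV_set1 x : leb [set x] = 0%E.
Proof.
apply/eqP; rewrite eq_le measure_ge0 andbT.
have -> : (0 = ((2 * 0 : R) ^+ d.+1)%:E :> \bar R)%E by rewrite mulr0 expr0n.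
rewrite -(box_measure x (lexx 0)).
apply: le_measure; rewrite ?inE.
- exact: rV_set1_measurable.
- exact: measurable_box.
- by move=> y -> i; rewrite /= in_itv/= !mxE addr0 subr0 lexx.
Qed.

End eball_measure.

(** * Distance to the boundary, charts and layers *)

Section boundary_distance.
Context (R : realType) (d : nat) (Omega : set 'rV[R]_d.+1).
Implicit Types (x y q : 'rV[R]_d.+1).

Local Notation delta := (bdist Omega).
Let D x := [set enorm (x - q) | q in boundary Omega].

Let D_lb x : has_lbound (D x).
Proof. by exists 0 => _ [q _ <-]. Qed.

Lemma bdist_le x q : boundary Omega q -> delta x <= enorm (x - q).
Proof. by move=> bq; apply: (ge_inf (D_lb x)); exists q. Qed.

Lemma bdist_ge0 x : 0 <= delta x.
Proof.
(* If the boundary is empty, the infimum is 0 by convention. *)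
have [D0|/set0P D0] := eqVneq (D x) set0; first by rewrite /bdist -/(D x) D0 inf0.
by rewrite /bdist; apply: lb_le_inf => // _ [q _ <-].
Qed.

Lemma boundary_closed : closed (boundary Omega).
Proof.
by apply: closedI; [exact: closed_closure|apply: open_closedC; exact: open_interior].
Qed.

Hypothesis Omega_bounded : bounded_set Omega.

Lemma Omega_norm_bound : exists2 M, 0 < M & forall x, Omega x -> `|x| <= M.
Proof.
have [M [_ hM]] := Omega_bounded.
exists (`|M| + 1); first by rewrite ltr_wpDl.
by move=> x Ox; apply: hM => //; rewrite ltr_pwDr// ler_norm.
Qed.

Lemma boundary_compact : compact (boundary Omega).
Proof.
apply: bounded_closed_compact; last exact: boundary_closed.
have [M M0 hM] := Omega_norm_bound.
exists (M + 1); split; first exact: num_real.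
move=> N MN q [cq _].
have [y [Oy qy]] := cq _ (nbhsx_ballx q 1 ltr01).
move: qy; rewrite -ball_normE/= => qy.
rewrite -[q](subrK y) (le_trans (ler_normD _ _))// (le_trans _ (ltW MN))//.
by rewrite [leRHS]addrC lerD ?hM// ltW.
Qed.

Hypothesis Omega_neq0 : Omega !=set0.
Hypothesis Omega_open : open Omega.

Lemma boundary_notin q : boundary Omega q -> ~ Omega q.
Proof. by move=> [_]; rewrite (iffLR (interior_id _) Omega_open). Qed.

(** If the segment missed the boundary, its part in [Omega] would be relatively open and relatively
    closed, since [Omega] and its closure agree off the boundary; by connectedness it would then
    contain y. *)
Lemma segment_boundary x y : Omega x -> ~ Omega y ->
  exists2 q, boundary Omega q & enorm (x - q) <= enorm (x - y).
Proof.
move=> Ox nOy; apply: contrapT => nq; apply: nOy.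
pose f (t : R) := x + t *: (y - x).
have cf : continuous f.
  move=> t; apply: (@cvgD _ _ _ (nbhs t) (nbhs_filter t)); first exact: cvg_cst.
  exact: scalel_continuous.
have f01 t : t \in `[0, 1]%R -> ~ boundary Omega (f t).
  rewrite in_itv/= => /andP[t0 t1] bq; apply: nq; exists (f t) => //.
  rewrite /f opprD addrA subrr add0r enormN enormZ ger0_norm// enormBC.
  by rewrite ler_piMl.
suff : `[0%R, 1%R]%classic `&` f @^-1` Omega = `[0%R, 1%R]%classic.
  move=> /seteqP[_ /(_ 1)]; rewrite /= in_itv/= ler01 lexx => -[]// _.
  by rewrite /f scale1r addrC subrK.
apply: segment_connected.
- by exists 0; split; rewrite /= ?in_itv/= ?lexx ?ler01// /f scale0r addr0.
- exists (f @^-1` Omega) => //.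
  by apply: open_comp => // t _; exact: cf.
- exists (f @^-1` closure Omega).
    by apply: closed_comp => [t _|]; [exact: cf|exact: closed_closure].
  apply/seteqP; split => t [t01 Of]; split=> //; first exact: subset_closure.
  apply: contrapT => nOf; apply: (f01 t t01); split => //.
  by rewrite (iffLR (interior_id _) Omega_open).
Qed.

(** A segment from inside [Omega] to a point beyond its sup-norm bound crosses the boundary. The
    infimum defining [bdist] thus runs over a nonempty set. *)
Lemma boundary_neq0 : boundary Omega !=set0.
Proof.
have [M M0 hM] := Omega_norm_bound; have [x Ox] := Omega_neq0.
have [|q bq _] := @segment_boundary x (const_mx (M + 1)) Ox; last by exists q.
move=> /hM; apply/negP; rewrite -ltNge.
rewrite (lt_le_trans _ (coord_le_norm _ ord0))// mxE.
by rewrite (lt_le_trans _ (ler_norm _))// ltrDl.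
Qed.

Let D_neq0 x : D x !=set0.
Proof. by have [q bq] := boundary_neq0; exists (enorm (x - q)), q. Qed.

Lemma bdist_lt x (e : R) : delta x < e ->
  exists2 q, boundary Omega q & enorm (x - q) < e.
Proof.
by move=> /(inf_lt (D_neq0 x))[_ [q bq <-] qe]; exists q.
Qed.

Lemma bdist_lip x y : delta x <= delta y + enorm (x - y).
Proof.
rewrite -lerBlDr; apply: (lb_le_inf (D_neq0 y)) => _ [q bq <-].
rewrite lerBlDr (le_trans (bdist_le x bq))// [leRHS]addrC.
exact: enorm_triangle.
Qed.

Lemma bdist_continuous : continuous delta.
Proof. by apply: (@lip_continuous _ _ _ 1) => x y; rewrite mul1r bdist_lip. Qed.

Lemma eball_bdist_sub x : Omega x -> eball x (delta x) `<=` Omega.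
Proof.
move=> Ox y; rewrite /eball/= => xy; apply: contrapT => nOy.
have [q bq qy] := segment_boundary Ox nOy.
by have := bdist_le x bq; apply/negP; rewrite -ltNge (le_lt_trans qy).
Qed.

Lemma bdist_ge_eball x (e : R) : eball x e `<=` Omega -> e <= delta x.
Proof.
move=> xe; apply: (lb_le_inf (D_neq0 x)) => _ [q bq <-]; rewrite leNgt; apply/negP => qe.
by apply: (boundary_notin bq); exact: xe.
Qed.

Lemma bdist_gt0 x : Omega x -> 0 < delta x.
Proof.
move=> Ox; have /nbhs_ballP[e /= e0 eO] : nbhs x Omega by exact: open_nbhs_nbhs.
apply: (lt_le_trans e0); apply: bdist_ge_eball => y xy; apply: eO.
by rewrite -ball_normE/= (le_lt_trans (norm_le_enorm _)).
Qed.

Lemma Omega_diameter : exists2 D, 0 < D &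
  (forall x y, Omega x -> Omega y -> enorm (x - y) < D) /\
  (forall x, Omega x -> delta x < D).
Proof.
have [M M0 hM] := Omega_norm_bound; have [x0 Ox0] := Omega_neq0.
pose D1 := d.+1%:R * (M + M) : R.
have xyD1 x y : Omega x -> Omega y -> enorm (x - y) <= D1.
  move=> Ox Oy; rewrite (le_trans (enorm_le_norm _))// ler_wpM2l//.
  by rewrite (le_trans (ler_normB _ _))// lerD// hM.
have D10 : 0 <= D1 by rewrite mulr_ge0// addr_ge0// ltW.
exists (D1 + delta x0 + 1); first by rewrite ltr_wpDl// addr_ge0// bdist_ge0.
split=> [x y Ox Oy|x Ox].
  by rewrite (le_lt_trans (xyD1 _ _ Ox Oy))// -addrA ltrDl ltr_wpDl// bdist_ge0.
rewrite (le_lt_trans (bdist_lip x x0))// [ltRHS]addrAC [ltRHS]addrC ltrD2l.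
by rewrite (le_lt_trans (xyD1 _ _ Ox Ox0))// ltrDl.
Qed.

Lemma measurable_Omega : measurable Omega.
Proof. exact: open_rV_measurable. Qed.

Lemma measurable_bdist : measurable_fun setT (delta : 'rV[R]_d.+1 -> measurableTypeR R).
Proof. by apply: continuous_rV_measurable; exact: bdist_continuous. Qed.

End boundary_distance.

Section C11_lipschitz.
Context (R : realType) (n : nat).

Lemma linear_enorm_bound (f : 'rV[R]_n -> R) : linear f ->
  exists2 M, 0 <= M & forall v, `|f v| <= M * enorm v.
Proof.
move=> lf; pose F : {linear 'rV[R]_n -> R} := HB.pack f (GRing.isLinear.Build _ _ _ _ f lf).
exists (\sum_(i < n) `|f (delta_mx 0 i)|); first by rewrite sumr_ge0.
move=> v; rewrite -[f]/(F : _ -> _) [in leLHS](row_sum_delta v) linear_sum.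
rewrite (le_trans (ler_norm_sum _ _ _))// mulr_suml ler_sum// => i _.
by rewrite linearZ normrM mulrC ler_wpM2l// coord_le_enorm.
Qed.

(** Mean value theorem on the segment from w to z: the Lipschitz condition bounds the norm of the
    differential on the ball of radius r by its bound at 0 plus |L| |r|. *)
Lemma C11_lipschitz (phi : 'rV[R]_n -> R) (r : R) : C11 phi ->
  exists2 K, 0 <= K & forall z w, enorm z <= r -> enorm w <= r ->
    phi z - phi w <= K * enorm (z - w).
Proof.
move=> [dphi [L hL]].
have [M M0 hM] := linear_enorm_bound (linearP ('d phi 0)).
exists (M + `|L| * `|r|) => [|z w zr wr]; first by rewrite addr_ge0// mulr_ge0.
pose psi (t : R) := w + t *: (z - w).
have der (t : R) : is_derive t (1 : R) (phi \o psi : R -> R) ('d phi (psi t) (z - w)).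
  (* Difference quotients along the segment are those of the directional derivative of [phi] in the
     direction z - w. *)
  have E : (fun h => h^-1 *: ((phi \o psi) (h *: 1 + t) - (phi \o psi) t)) =
           (fun h => h^-1 *: (phi (h *: (z - w) + psi t) - phi (psi t))).
    apply/funext => h /=; congr (_ *: (phi _ - _)).
    have -> : h *: (1 : R) = h by rewrite /GRing.scale/= mulr1.
    by rewrite /psi scalerDl addrCA.
  have dv := diff_derivable (dphi (psi t)) (v := z - w).
  apply: DeriveDef; first by rewrite /derivable E.
  by rewrite /derive E -deriveE.
have cpsi : {within `[0, 1], continuous (phi \o psi)}.
  apply: derivable_within_continuous => t _.
  by have := der t => -[].
have [c] := MVT ltr01 (fun t _ => der t) cpsi.
rewrite in_itv/= => /andP[c0 c1].
rewrite /psi /= scale1r scale0r addr0 subr0 mulr1 [w + _]addrC subrK => ->.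
set u := w + _.
have ur : enorm u <= r.
  rewrite (_ : u = (1 - c) *: w + c *: z); last first.
    by rewrite /u scalerBr scalerBl scale1r -addrA [- _ + _]addrC.
  rewrite (le_trans (enormD _ _))// !enormZ !ger0_norm ?subr_ge0 ?(ltW c0) ?(ltW c1)//.
  rewrite (_ : r = (1 - c) * r + c * r); last by ring.
  by rewrite lerD// ler_wpM2l ?subr_ge0 ?(ltW c0) ?(ltW c1).
have h1 : 'd phi u (z - w) - 'd phi 0 (z - w) <= `|L| * `|r| * enorm (z - w).
  apply: le_trans (ler_norm _) _; apply: (le_trans (hL _ _ _)).
  rewrite subr0 ler_wpM2r// (le_trans (ler_wpM2r _ (ler_norm L)))//.
  by rewrite ler_wpM2l// (le_trans ur)// ler_norm.
have h2 := le_trans (ler_norm _) (hM (z - w)).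
by have := lerD h2 h1; rewrite [leLHS]addrC subrK -mulrDl.
Qed.

End C11_lipschitz.

(** * Boundary charts in terms of a height function, uniform over the boundary *)

Section charts.
Context (R : realType) (d : nat).
Implicit Types (Omega : set 'rV[R]_d.+1) (p q e : 'rV[R]_d.+1).

(* [h] is the height above the boundary measured along [e]. *)
Definition height_chart Omega p (r K : R) e (h : 'rV[R]_d.+1 -> R) : Prop :=
  [/\ enorm e <= K,
      forall y tau, h (y + tau *: e) = h y + tau,
      forall y, eball p r y -> (Omega y <-> 0 < h y) &
      forall y z, eball p r y -> eball p r z -> h y - h z <= K * enorm (y - z)].

Lemma height_chart_sub Omega p q (r r' K K' : R) e h :
  eball q r' `<=` eball p r -> K <= K' ->
  height_chart Omega p r K e h -> height_chart Omega q r' K' e h.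
Proof.
move=> pq KK' [eK he hO hL]; split => //; first exact: le_trans KK'.
  by move=> y /pq; exact: hO.
move=> y z /pq py /pq pz; rewrite (le_trans (hL _ _ py pz))//.
by rewrite ler_wpM2r.
Qed.

Lemma orthogonal_enorm n (Q : 'M[R]_n) (v : 'rV[R]_n) :
  Q *m Q^T = 1%:M -> enorm (v *m Q) = enorm v.
Proof.
move=> QQ; have E (u : 'rV[R]_n) : enorm u = Num.sqrt ((u *m u^T) 0 0).
  by rewrite /enorm mxE; under [in RHS]eq_bigr do rewrite mxE -expr2.
by rewrite !E trmx_mul mulmxA -(mulmxA v) QQ mulmx1.
Qed.

Lemma enorm_col' n (i : 'I_n.+1) (v : 'rV[R]_n.+1) : enorm (col' i v) <= enorm v.
Proof.
rewrite /enorm ler_wsqrtr// [leRHS](bigD1_ord i)//= ler_wpDl ?sqr_ge0//.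
by apply: ler_sum => j _; rewrite mxE.
Qed.

(** In the rotated frame [h] is the last coordinate minus [phi] of the others, and [e] corresponds
    to the last basis vector. In the constant 1 + L, the 1 comes from the coordinate and L from
    [phi]. *)
Lemma C11_boundary_chart Omega p : C11_boundary Omega -> boundary Omega p ->
  exists r K e h, 0 < r /\ height_chart Omega p r K e h.
Proof.
move=> C11O /C11O[r [Q [phi [r0 QQ C11phi hO]]]].
have [L L0 hL] := C11_lipschitz r C11phi.
pose w y := (y - p) *m Q; pose h y := w y 0 ord_max - phi (col' ord_max (w y)).
pose e : 'rV[R]_d.+1 := delta_mx 0 ord_max *m Q^T.
have eQ : e *m Q = delta_mx 0 ord_max by rewrite -mulmxA (mulmx1C QQ) mulmx1.
have e1 : enorm e = 1.
  rewrite -(orthogonal_enorm _ QQ) eQ /enorm (bigD1 ord_max)//= big1 => [|i /negPf ni].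
    by rewrite mxE !eqxx expr1n addr0 sqrtr1.
  by rewrite mxE eqxx ni/= expr0n.
have wB y z : w y - w z = (y - z) *m Q by rewrite -mulmxBl opprB addrA subrK.
exists r, (1 + L), e, h; split => //; split.
- by rewrite e1 lerDl.
- move=> y tau.
  have wD : w (y + tau *: e) = w y + tau *: delta_mx 0 ord_max.
    by rewrite /w addrAC mulmxDl -scalemxAl eQ.
  rewrite /h wD; move: (w y) => W.
  have -> : col' ord_max (W + tau *: delta_mx 0 ord_max) = col' ord_max W.
    by apply/rowP => j; rewrite !mxE eqxx/= eq_sym (negPf (neq_lift _ _)) mulr0 addr0.
  have -> : (W + tau *: delta_mx 0 ord_max) 0 ord_max = W 0 ord_max + tau.
    by rewrite !mxE !eqxx mulr1.
  by rewrite addrAC.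
- by move=> y py; rewrite /h subr_gt0; apply: hO; rewrite enormBC.
- move=> y z py pz.
  have wr u : eball p r u -> enorm (col' ord_max (w u)) <= r.
    move=> pu; rewrite (le_trans (enorm_col' _ _))// orthogonal_enorm//.
    by rewrite enormBC ltW.
  rewrite /h opprD opprK addrACA mulrDl mul1r lerD//.
    apply: le_trans (ler_norm _) _.
    have -> : w y 0 ord_max - w z 0 ord_max = (w y - w z) 0 ord_max.
      by move: (w y) (w z) => W Z; rewrite !mxE.
    by rewrite wB -(orthogonal_enorm (y - z) QQ) coord_le_enorm.
  rewrite addrC (le_trans (hL _ _ (wr z pz) (wr y py)))// ler_wpM2l//.
  have -> : col' ord_max (w z) - col' ord_max (w y) = col' ord_max (w z - w y).
    by move: (w y) (w z) => W Z; apply/rowP => j; rewrite !mxE.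
  by rewrite (le_trans (enorm_col' _ _))// wB orthogonal_enorm// enormBC.
Qed.

(** Compactness: finitely many balls of half the chart radius cover the boundary, and a point q in
    the half ball of p inherits the chart of p on a ball of uniform radius. Only finitely many pairs
    ([e p], [h p]) occur, though q is arbitrary. *)
Lemma bounded_C11_charts Omega : bounded_C11_domain Omega ->
  exists (s : seq 'rV[R]_d.+1) (e : 'rV[R]_d.+1 -> 'rV[R]_d.+1)
    (h : 'rV[R]_d.+1 -> 'rV[R]_d.+1 -> R) (r K : R),
  [/\ 0 < r, 1 <= K & forall q, boundary Omega q ->
    exists2 p, p \in s & height_chart Omega q r K (e p) (h p)].
Proof.
move=> [nO oO _ bO C11O].
have : forall p, exists (a : R * R * 'rV[R]_d.+1 * ('rV[R]_d.+1 -> R)),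
    boundary Omega p -> 0 < a.1.1.1 /\ height_chart Omega p a.1.1.1 a.1.1.2 a.1.2 a.2.
  (* Off the boundary a dummy tuple lets the choice be made for every p. *)
  move=> p; have [bp|nbp] := pselect (boundary Omega p); last by exists (0, 0, 0, cst 0).
  by have [r [K [e [h H]]]] := C11_boundary_chart C11O bp; exists (r, K, e, h).
move=> /choice[a aP].
have := boundary_compact bO; rewrite compact_cover.
move=> /(_ _ (boundary Omega) (fun p => eball p ((a p).1.1.1 / 2))).
case=> [p _|p bp|s sO scov]; first exact: open_eball.
  exists p => //; rewrite /eball/= subrr enorm0.
  by have [? _] := aP p bp; rewrite divr_gt0.
have [r [K [r0 K1 rK]]] : exists r K, [/\ 0 < r, 1 <= K &
    forall p, p \in finmap.enum_fset s -> r <= (a p).1.1.1 / 2 /\ (a p).1.1.2 <= K].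
  have : forall p, p \in finmap.enum_fset s -> 0 < (a p).1.1.1.
    by move=> p ps; have /aP[] : boundary Omega p by apply/set_mem/sO.
  elim: (finmap.enum_fset s) => [|p l IH] H; first by exists 1, 1.
  have [|r [K [r0 K1 rK]]] := IH; first by move=> q ql; apply: H; rewrite inE ql orbT.
  exists (Num.min r ((a p).1.1.1 / 2)), (Num.max K (a p).1.1.2); split.
  - by rewrite lt_min r0 divr_gt0// H// inE eqxx.
  - by rewrite le_max K1.
  - move=> q; rewrite inE => /predU1P[->|/rK[h1 h2]].
      by rewrite ge_min le_max !lexx !orbT.
    by rewrite ge_min le_max h1 h2.
exists (finmap.enum_fset s), (fun p => (a p).1.2), (fun p => (a p).2), r, K; split => //.
move=> q /scov[p /= ps pq]; exists p => //.
have [rp Kp] := rK p ps.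
have /aP[a0] : boundary Omega p by apply/set_mem/sO.
apply: height_chart_sub => //; apply: eball_subset.
rewrite (splitr (a p).1.1.1) lerD//; exact: ltW.
Qed.

End charts.

(** * Measure of boundary layers, and interior balls at every small scale *)

Section layers.
Context (R : realType) (d : nat).
Local Notation leb := (lebesgue_rV R d.+1).
Implicit Types (x y q v : 'rV[R]_d.+1).

(** A packing bound: by translation invariance, M disjoint translates of [S] inside [B] have total
    measure M times that of [S]. *)
Lemma disjoint_shifts_measure (S B : set 'rV[R]_d.+1) v (M : nat) :
  measurable S -> measurable B ->
  (forall j, (j < M)%N -> forall y, S (y + j%:R *: v) -> B y) ->
  (forall i j y, S (y + i%:R *: v) -> S (y + j%:R *: v) -> i = j) ->
  (M%:R%:E * leb S <= leb B)%E.
Proof.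
move=> mS mB SB Sij; pose F (j : nat) := (fun y => y + j%:R *: v) @^-1` S.
have mF j : measurable (F j).
  by rewrite -[X in measurable X]setTI; exact: measurable_rV_shift.
have mU : measurable (\big[setU/set0]_(j < M) F j).
  by apply: bigsetU_measurable => j _; exact: mF.
apply: (@le_trans _ _ (leb (\big[setU/set0]_(j < M) F j))); last first.
  apply: le_measure; rewrite ?inE// -bigcup_mkord => y [j /= jM Fy].
  exact: SB jM _ Fy.
rewrite measure_semi_additive_ord_I//; last first.
  by move=> i j _ _ [y [Fi Fj]]; exact: Sij Fi Fj.
rewrite (eq_bigr (fun=> leb S)) => [|j _]; last exact: lebesgue_rV_shift.
by rewrite sumr_const card_ord mule_natl.
Qed.

Lemma open_layer (Omega : set 'rV[R]_d.+1) (Q : set 'rV[R]_d.+1) x (t e : R) :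
  open Omega -> open (Omega `&` eball x t `&` \bigcup_(q in Q) eball q e).
Proof.
move=> oO; apply: openI; first by apply: openI => //; exact: open_eball.
by apply: bigcup_open => q _; exact: open_eball.
Qed.

Variable Omega : set 'rV[R]_d.+1.
Hypothesis hOmega : bounded_C11_domain Omega.
Local Notation delta := (bdist Omega).

Let nO : Omega !=set0. Proof. by case: hOmega. Qed.
Let oO : open Omega. Proof. by case: hOmega. Qed.
Let bO : bounded_set Omega. Proof. by case: hOmega. Qed.

(* The translates of a layer of thickness [e] by multiples of [K * e] in the
   chart direction are pairwise disjoint, and about [t / e] of them fit in a
   ball of radius comparable to [t]. *)
Lemma chart_layer_measure (r K e t : R) x v h (Q : set 'rV[R]_d.+1) :
  1 <= K -> 0 < e -> e <= t -> e <= r ->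
  Q `<=` boundary Omega -> (forall q, Q q -> height_chart Omega q r K v h) ->
  (leb (Omega `&` eball x t `&` \bigcup_(q in Q) eball q e) <=
    (2 * (2 * (1 + K ^+ 2)) ^+ d.+1 * e * t ^+ d)%:E)%E.
Proof.
move=> K1 e0 et er Qb Qh; set S := (X in leb X).
have mS : measurable S by apply: open_rV_measurable; exact: open_layer.
have K0 : 0 < K by exact: lt_le_trans K1.
have t0 : 0 < t by exact: lt_le_trans et.
have [S0|/set0P[y0 [_ [q0 Qq0 _]]]] := eqVneq S set0.
  rewrite S0 measure0 lee_fin !mulr_ge0// ?exprn_ge0// ?ltW//.
  by rewrite mulr_gt0// ltr_wpDr// exprn_ge0// ltW.
have [vK hv _ _] := Qh _ Qq0.
(* A point of the layer has positive height because it lies in [Omega]. It is within e of a boundary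
   point, whose height is at most 0 because [Omega] is open, so its own height is below K e. *)
have hS y : S y -> 0 < h y < K * e.
  move=> [[Oy _] [q Qq qy]]; have [_ _ hO hL] := Qh _ Qq.
  have qry : eball q r y by exact: lt_le_trans er.
  have qrq : eball q r q by rewrite /eball/= subrr enorm0 (lt_le_trans _ er).
  have hq : h q <= 0.
    rewrite leNgt; apply/negP => /(iffRL (hO q qrq)).
    by apply: boundary_notin => //; exact: Qb.
  rewrite (iffLR (hO y qry) Oy)/=.
  have := hL _ _ qry qrq; rewrite enormBC lerBlDr => /le_lt_trans; apply.
  by rewrite -ltrBrDr (lt_le_trans (y := K * e))// ?ltr_pM2l// lerDl oppr_ge0.
(* Since e <= t, M is at least 1, whence t / e <= M + 1 <= 2 M. *)
pose M := Num.truncn (t / e).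
have te1 : 1 <= t / e by rewrite ler_pdivlMr// mul1r.
have te0 : 0 <= t / e by exact: le_trans te1.
have M1 : 1 <= M%:R :> R by rewrite ler1n truncn_gt0.
have Mle : M%:R <= t / e by rewrite truncn_le.
have Mgt : t / e <= 2 * M%:R.
  by rewrite (le_trans (ltW (truncnS_gt _)))// -natr1 mulr_natl mulr2n lerD2l.
have sh (j : nat) : j%:R *: (- (K * e) *: v) = - (K * e * j%:R) *: v.
  by rewrite scalerA mulrN mulrC.
(* The j-th translate occupies the heights between K e j and K e (j + 1); these bands are
   disjoint. *)
have hsh (j : nat) y : S (y + j%:R *: (- (K * e) *: v)) ->
    K * e * j%:R < h y < K * e * (j%:R + 1).
  rewrite sh => /hS; rewrite hv subr_gt0 mulrDr mulr1 => /andP[-> /=].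
  by rewrite ltrBlDl.
have := @disjoint_shifts_measure S (eball x ((1 + K ^+ 2) * t)) (- (K * e) *: v) M mS
  (measurable_eball _ _).
have Ke0 : 0 < K * e by rewrite mulr_gt0.
move=> H; have {}H : (M%:R%:E * leb S <= leb (eball x ((1 + K ^+ 2) * t)))%E.
  (* For j < M the displacement is at most K e j |v| <= K^2 e M <= K^2 t, which explains the radius
     (1 + K^2) t. *)
  apply: H => [j jM y|i j y /hsh + /hsh].
    rewrite sh => -[[_ xy] _]; rewrite /eball/=.
    apply: le_lt_trans (enorm_triangle _ (y + - (K * e * j%:R) *: v) _) _.
    rewrite mulrDl mul1r ltr_leD// addrAC subrr add0r.
    rewrite enormZ normrN ger0_norm; last by rewrite mulr_ge0// ltW.
    rewrite (@le_trans _ _ (K * e * j%:R * K))// ?ler_wpM2l//; first by rewrite mulr_ge0// ltW.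
    rewrite (_ : _ * K = K ^+ 2 * (e * j%:R)); last by ring.
    rewrite ler_wpM2l ?sqr_ge0// mulrC -ler_pdivlMr//.
    by rewrite (le_trans _ Mle)// ler_nat ltnW.
  move=> /andP[i1 i2] /andP[j1 j2].
  have := lt_trans i1 j2; have := lt_trans j1 i2.
  rewrite !ltr_pM2l// !natr1 !ltr_nat !ltnS => ji ij.
  by apply/eqP; rewrite eqn_leq ij.
have KT0 : 0 <= (1 + K ^+ 2) * t.
  by rewrite mulr_ge0// ?ltW// ltr_wpDr// sqr_ge0.
have {}H := le_trans H (eball_measure_le x KT0).
have fS : leb S \is a fin_num.
  rewrite ge0_fin_numE// (@le_lt_trans _ _ (leb (eball x t)))//.
    apply: le_measure; rewrite ?inE//; first exact: measurable_eball.
    by move=> y [[]].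
  by rewrite (le_lt_trans (eball_measure_le _ (ltW t0)))// ltry.
rewrite -(fineK fS) lee_fin; move: H; rewrite -(fineK fS) -EFinM lee_fin.
set m := fine _ => H.
have m0 : 0 <= m by rewrite fine_ge0.
have H2 : t * m <= 2 * e * ((2 * (1 + K ^+ 2)) ^+ d.+1 * t ^+ d.+1).
  rewrite -exprMn -[2 * (1 + _) * t]mulrA.
  apply: (@le_trans _ _ (2 * e * (M%:R * m))); last by rewrite ler_wpM2l// mulr_ge0// ltW.
  rewrite mulrA ler_wpM2r//; move: Mgt; rewrite ler_pdivrMr// => /le_trans -> //.
  by rewrite mulrAC.
rewrite -(ler_pM2l t0) (le_trans H2)// exprS le_eqVlt; apply/orP; left; apply/eqP.
by rewrite [t ^+ d.+1]exprS; ring.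
Qed.

Lemma measure_bigsetU_le (I : Type) (s : seq I) (F : I -> set 'rV[R]_d.+1) (b : \bar R) :
  (forall i, measurable (F i)) -> (forall i, leb (F i) <= b)%E ->
  (leb (\big[setU/set0]_(i <- s) F i) <= (size s)%:R%:E * b)%E.
Proof.
move=> mF Fb; have b0 (i : I) : (0 <= b)%E by rewrite (le_trans _ (Fb i)).
elim: s => [|i s IH]; first by rewrite big_nil measure0 mul0e.
rewrite big_cons (le_trans (measureU2 _ _ _))//.
  by apply: bigsetU_measurable => j _; exact: mF.
rewrite -[size _]/(size s).+1 -nat1r EFinD ge0_muleDl ?lee_fin// mul1e.
by apply: leeD => //; exact: Fb.
Qed.

(** For e <= r the layer is covered by one piece per chart of the finite family. For e > r the
    volume of the ball suffices: t^(d+1) <= T t^d <= (T / r) e t^d. *)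
Lemma layer_measure (T : R) : exists2 C, 0 < C & forall x (e t : R),
  0 < e -> e <= t -> t <= T ->
  (leb (Omega `&` eball x t `&` [set y | (delta y < e)%R]) <= (C * e * t ^+ d)%:E)%E.
Proof.
have [s [v [h [r [K [r0 K1 hc]]]]]] := bounded_C11_charts hOmega.
pose C1 := 2 * (2 * (1 + K ^+ 2)) ^+ d.+1.
have C10 : 0 < C1.
  by rewrite mulr_gt0// exprn_gt0// mulr_gt0// ltr_wpDr// sqr_ge0.
exists ((size s).+1%:R * C1 + 2 ^+ d.+1 * `|T| / r).
  apply: ltr_pwDl; first by rewrite mulr_gt0// ltr0n.
  by rewrite divr_ge0 ?mulr_ge0 ?exprn_ge0// ltW.
move=> x e t e0 et tT; have t0 : 0 < t by exact: lt_le_trans et.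
have T0 : 0 < T by exact: lt_le_trans tT.
set S := (X in leb X).
have mS : measurable S.
  apply: measurableI.
    by apply: measurableI; [exact: measurable_Omega|exact: measurable_eball].
  rewrite [X in measurable X](_ : _ = setT `&` delta @^-1` `]-oo, e[%classic).
    by apply: measurable_bdist.
  by apply/seteqP; split => y; rewrite /= in_itv/= => // -[].
have [er|re] := leP e r.
  (* Boundary points are grouped by chart, so that each group has a single height function. *)
  pose Q p := [set q | boundary Omega q /\ height_chart Omega q r K (v p) (h p)].
  pose F p := Omega `&` eball x t `&` \bigcup_(q in Q p) eball q e.
  have mF p : measurable (F p) by apply: open_rV_measurable; exact: open_layer.
  have Fb p : (leb (F p) <= (C1 * e * t ^+ d)%:E)%E.
    by apply: (@chart_layer_measure r K _ _ _ (v p) (h p)) => // q [].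
  apply: (@le_trans _ _ (leb (\big[setU/set0]_(p <- s) F p))).
    apply: le_measure; rewrite ?inE//; first exact: bigsetU_measurable.
    move=> y [[Oy xy] /= ye].
    have [q bq qy] := bdist_lt bO nO oO ye.
    have [p ps hp] := hc q bq.
    rewrite -bigcup_seq; exists p => //; split => //; exists q => //.
    by rewrite /eball/= enormBC.
  rewrite (le_trans (measure_bigsetU_le _ mF Fb))// -EFinM lee_fin.
  rewrite [leLHS](_ : _ = (size s)%:R * C1 * (e * t ^+ d)); last by ring.
  rewrite -[leRHS]mulrA ler_wpM2r ?mulr_ge0 ?exprn_ge0 ?(ltW e0) ?(ltW t0)//.
  rewrite ler_wpDr ?divr_ge0 ?mulr_ge0 ?(ltW r0)//.
  by rewrite ler_wpM2r ?(ltW C10)// ler_nat.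
apply: (@le_trans _ _ (leb (eball x t))).
  apply: le_measure; rewrite ?inE//; first exact: measurable_eball.
  by move=> y [[]].
rewrite (le_trans (eball_measure_le _ (ltW t0)))// lee_fin.
rewrite exprMn [t ^+ d.+1]exprS -[leRHS]mulrA mulrDl.
rewrite ler_wpDl//.
  apply: mulr_ge0; first exact: (mulr_ge0 (ler0n _ _) (ltW C10)).
  exact: (mulr_ge0 (ltW e0) (exprn_ge0 _ (ltW t0))).
rewrite !mulrA ler_wpM2r ?exprn_ge0 ?(ltW t0)// -!mulrA ler_wpM2l ?exprn_ge0//.
rewrite (ger0_norm (ltW T0)) (le_trans tT)// ler_peMr ?(ltW T0)//.
by rewrite ler_pdivlMl// mulr1 ltW.
Qed.

(* [h] is the height of a chart relative to its value at [x]; it keeps the balls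
   at the scales [tau = 4^k r] apart. *)
Lemma corkscrew : exists r0 K, [/\ 0 < r0, 1 <= K & forall x, Omega x -> delta x < r0 ->
  exists v (h : 'rV[R]_d.+1 -> R), forall tau y, 0 < tau <= r0 ->
    eball (x + tau *: v) (tau / (2 * K)) y ->
    [/\ Omega y, tau / (2 * K) <= delta y, enorm (x - y) <= 2 * K * tau &
      tau / 2 < h y < 3 * tau / 2]].
Proof.
have [s [v [h [r [K [r0 K1 hc]]]]]] := bounded_C11_charts hOmega.
have K0 : 0 < K by exact: lt_le_trans K1.
have KK : 1 <= K * K by rewrite -[1]mulr1 ler_pM.
(* With this bound on delta(x) and tau, the distance from x to q, the displacement of x by tau v and
   the radius tau / K are each at most r/4, so everything stays in the chart ball around q. *)
exists (r / (4 * K)), K; split => //; first by rewrite divr_gt0 ?mulr_gt0.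
move=> x Ox xr.
have rK4 : r / (4 * K) <= r / 4.
  by rewrite ler_wpM2l ?(ltW r0)// lef_pV2 ?posrE ?mulr_gt0// ler_pMr.
have [q bq xq] := bdist_lt bO nO oO (lt_le_trans xr rK4).
have [p _ [vK hv hO hL]] := hc q bq.
exists (v p), (fun y => h p y - h p x) => tau y /andP[tau0 taur].
set z := x + _ => zy.
have Ktau : K * tau <= r / 4.
  move: taur; rewrite !ler_pdivlMr ?mulr_gt0//.
  by have -> : K * tau * 4 = tau * (4 * K) by ring.
have tauK : tau / K <= K * tau.
  by rewrite ler_pdivrMr// mulrAC ler_peMl// ltW.
have tauK2 : tau / (2 * K) = tau / K / 2 by rewrite invfM mulrA mulrAC.
have tK0 : 0 < tau / K by rewrite divr_gt0.
have xz : enorm (x - z) <= K * tau.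
  rewrite /z opprD addrA subrr add0r enormN enormZ gtr0_norm//.
  by rewrite mulrC ler_wpM2r// ltW.
have qx : eball q r x by rewrite /eball/= enormBC (lt_trans xq)//; lra.
have qzu u : enorm (z - u) < tau / K -> eball q r u.
  move=> zu; rewrite /eball/=; have := enorm_triangle q x u.
  have := enorm_triangle x z u; rewrite enormBC in xq; move: tauK Ktau xz xq zu.
  by lra.
have qz : eball q r z by apply: qzu; rewrite subrr enorm0.
have hz : h p z = h p x + tau by rewrite hv.
have hx : 0 < h p x by apply/hO.
have hzu u : eball q r u -> h p z - h p u <= K * enorm (z - u) /\
                            h p u - h p z <= K * enorm (z - u).
  by move=> qu; split; [exact: hL|rewrite (enormBC z); exact: hL].
(* The height of z exceeds tau, so the Lipschitz constant K keeps it positive within tau / K. The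
   ball of half that radius leaves room for the bound on delta(y) and changes the height by less
   than tau / 2. *)
have zK : eball z (tau / K) `<=` Omega.
  move=> u zu; have qu := qzu u zu; apply/(hO u qu).
  have [+ _] := hzu u qu; have : K * enorm (z - u) < tau.
    by rewrite mulrC -ltr_pdivlMr.
  by rewrite hz; lra.
have zy' : enorm (z - y) < tau / K.
  by rewrite (lt_trans zy)// tauK2 ltr_pdivrMr// ltr_pMr// ltr1n.
have qy := qzu y zy'.
split; first exact: zK.
- apply: (bdist_ge_eball bO nO oO); apply: subset_trans zK; apply: eball_subset.
  by rewrite tauK2; move: zy; rewrite /eball/= tauK2; lra.
- have := enorm_triangle x z y; move: tauK xz zy'; lra.
- have [h1 h2] := hzu y qy; have : K * enorm (z - y) < tau / 2.
    move: zy; rewrite /eball/= tauK2 mulrAC ltr_pdivlMr// mulrC => ?.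
    by [].
  by move: h1 h2; rewrite hz; lra.
Qed.

End layers.

(** * Dyadic integration *)

Section powers.
Context (R : realType).
Implicit Types (a x y r : R).

Lemma powR_exprn x (j : nat) a : 0 <= x -> (x ^+ j) `^ a = (x `^ a) ^+ j.
Proof.
by move=> x0; rewrite -(powR_mulrn j x0) -(powR_mulrn j (powR_ge0 x a)) -!powRrM mulrC.
Qed.

(** The power is increasing or decreasing according to the sign of [p]; the constant adds the values
    at both ends and their inverses, so that it serves both cases. *)
Lemma powR_comparable (p lo hi : R) : 0 < lo -> exists2 c, 0 < c &
  forall t u, 0 < t -> lo * t <= u -> u <= hi * t ->
    c^-1 * t `^ p <= u `^ p /\ u `^ p <= c * t `^ p.
Proof.
move=> lo0; pose M := Num.max lo hi.
have M0 : 0 < M by rewrite lt_max lo0.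
exists (lo `^ p + M `^ p + (lo `^ p)^-1 + (M `^ p)^-1).
  by rewrite !addr_gt0 ?invr_gt0 ?powR_gt0.
move=> t u t0 tu ut.
have {}ut : u <= M * t.
  by rewrite (le_trans ut)// ler_wpM2r ?(ltW t0)// le_max lexx orbT.
have u0 : 0 < u by rewrite (lt_le_trans _ tu)// mulr_gt0.
set c := (X in X^-1).
have lp := powR_gt0 p lo0; have Mp := powR_gt0 p M0.
have ilp : 0 < (lo `^ p)^-1 by rewrite invr_gt0.
have iMp : 0 < (M `^ p)^-1 by rewrite invr_gt0.
have c0 : 0 < c by rewrite !addr_gt0.
have tp := powR_gt0 p t0.
have [clo cM] : c^-1 <= lo `^ p /\ c^-1 <= M `^ p.
  by split; rewrite -[leRHS]invrK lef_pV2 ?posrE// /c; lra.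
have [loc Mc] : lo `^ p <= c /\ M `^ p <= c by rewrite /c; split; lra.
have T0 := ltW t0; have LO := ltW lo0; have MO := ltW M0.
have homo x y (r : R) : 0 <= r -> 0 <= x -> x <= y -> x `^ r <= y `^ r.
  by move=> r0 x0 xy; rewrite ge0_ler_powR// nnegrE// (le_trans x0).
suff [k [K [kc Kc h1 h2]]] : exists k K, [/\ c^-1 <= k, K <= c,
    k * t `^ p <= u `^ p & u `^ p <= K * t `^ p].
  split; first by rewrite (le_trans _ h1)// ler_wpM2r// ltW.
  by rewrite (le_trans h2)// ler_wpM2r// ltW.
have [p0|p0] := leP 0 p.
  exists (lo `^ p), (M `^ p); split => //.
    by rewrite -powRM// homo// mulr_ge0.
  by rewrite -powRM// homo// ltW.
have anti x y : 0 < x -> x <= y -> y `^ p <= x `^ p.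
  move=> x0 xy; have y0 : 0 < y by exact: lt_le_trans xy.
  rewrite -[p]opprK !(powRN _ (- p)) lef_pV2 ?posrE ?powR_gt0//.
  by rewrite homo ?oppr_ge0 ?(ltW p0) ?(ltW x0).
exists (M `^ p), (lo `^ p); split => //.
  by rewrite -powRM// anti.
by rewrite -powRM// anti// mulr_gt0.
Qed.

(** Bernoulli's inequality in the form k (q - 1) <= q^k. *)
Lemma exprn_gt_archi (q M : R) : 1 < q -> exists n : nat, M < q ^+ n.
Proof.
move=> q1; pose n := Num.truncn (`|M| / (q - 1)).
exists n.+1; have q10 : 0 < q - 1 by rewrite subr_gt0.
have bern (k : nat) : k%:R * (q - 1) <= q ^+ k.
  elim: k => [|k IH]; first by rewrite mul0r expr0.
  rewrite -nat1r mulrDl mul1r exprS.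
  have -> : q * q ^+ k = (q - 1) * q ^+ k + q ^+ k by ring.
  apply: lerD => //.
  by rewrite ler_peMr ?(ltW q10)// exprn_ege1// ltW.
apply: lt_le_trans (bern n.+1); rewrite -ltr_pdivrMr//.
rewrite (le_lt_trans _ (truncnS_gt _))// ler_wpM2r ?invr_ge0 ?(ltW q10)//.
exact: ler_norm.
Qed.

Lemma sum_geometric_le (q : R) (n : nat) : 0 <= q < 1 -> \sum_(i < n) q ^+ i <= (1 - q)^-1.
Proof.
move=> /andP[q0 q1]; have q10 : 0 < 1 - q by rewrite subr_gt0.
rewrite -[leRHS]mul1r ler_pdivlMr// mulrC -[1 - q]opprB mulNr -subrX1 opprB.
by rewrite gerBl exprn_ge0.
Qed.

End powers.

(* Layer cake over the dyadic shells [2^-(j+1) rho <= u < 2^-j rho]. *)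
Lemma dyadic_integral (d : measure_display) (T : measurableType d) (R : realType)
    (mu : {measure set T -> \bar R}) (a m : R) : 0 < a + m ->
  exists2 C, 0 < C & forall (E : set T) (u : T -> R) (A rho : R),
    measurable E -> measurable_fun setT u -> 0 <= A -> 0 < rho ->
    (forall y, E y -> 0 <= u y < rho) ->
    (forall e, 0 < e <= rho -> (mu (E `&` [set y | (u y < e)%R]) <= (A * e `^ m)%:E)%E) ->
    (\int[mu]_(y in E) (u y `^ a)%:E <= (C * A * rho `^ (a + m))%:E)%E.
Proof.
move=> am0; pose q : R := 2^-1 `^ (a + m).
have half0 : 0 < 2^-1 :> R by rewrite invr_gt0.
have q0 : 0 < q by exact: powR_gt0.
have q1 : q < 1.
  have half1 : 2^-1 < 1 :> R by rewrite invf_lt1 ?ltr1n.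
  by have := gt0_ltr_powR am0 _ _ half1; rewrite powR1 !nnegrE (ltW half0) ler01; exact.
(* On the shell w_j / 2 <= u < w_j, u^a is at most w_j^a if a >= 0 and at most 2^(-a) w_j^a if a <
   0. *)
pose c : R := Num.max 1 (2^-1 `^ a).
have c1 : 1 <= c by rewrite le_max lexx.
have c0 : 0 < c by exact: lt_le_trans c1.
exists (c / (1 - q)); first by rewrite divr_gt0// subr_gt0.
move=> E u A rho mE mu_ A0 rho0 uE layer.
pose w (j : nat) := 2^-1 ^+ j * rho.
have w0 j : 0 < w j by rewrite mulr_gt0// exprn_gt0.
have wrho j : w j <= rho.
  by rewrite ler_piMl ?(ltW rho0)// exprn_ile1 ?(ltW half0)// invf_le1 ?ler1n.
pose F j := E `&` [set y | u y < w j].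
have mF j : measurable (F j).
  apply: measurableI => //.
  rewrite [X in measurable X](_ : _ = setT `&` u @^-1` `]-oo, w j[%classic).
    exact: mu_.
  by apply/seteqP; split => y; rewrite /= in_itv/= => // -[].
(* The indicator is that of the whole sublevel set u < w_j, whose measure the hypothesis
   controls. *)
pose f j y : \bar R := ((c * w j `^ a)%:E * (\1_(F j) y)%:E)%E.
have cw0 j : (0 <= (c * w j `^ a)%:E)%E by rewrite lee_fin mulr_ge0 ?powR_ge0 ?(ltW c0).
have f0 j y : (0 <= f j y)%E by rewrite mule_ge0// lee_fin.
have mf j : measurable_fun E (f j).
  apply: measurable_funTS; apply/measurable_EFinP; apply: measurable_funM => //.
have uf y : E y -> ((u y `^ a)%:E <= \sum_(0 <= j <oo) f j y)%E.
  move=> Ey; have /andP[u0 ur] := uE _ Ey.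
  suff [j uj] : exists j, ((u y `^ a)%:E <= f j y)%E.
    apply: (le_trans uj); apply: le_trans (nneseries_lim_ge j.+1 _) => //.
    by rewrite big_nat_recr//= leeDr// sume_ge0.
  (* Where u = 0 no shell applies; 0^a is 0 for a nonzero and 1 for a = 0, and the term j = 0
     dominates either value. *)
  move: u0; rewrite le_eqVlt => /predU1P[u0|u0].
    exists 0%N; rewrite /f indicE mem_set ?mule1; last first.
      by split => //=; rewrite -u0.
    rewrite lee_fin -u0 /w expr0 mul1r; have [->|a0] := eqVneq a 0.
      by rewrite !powRr0 mulr1.
    by rewrite powR0// mulr_ge0// ?powR_ge0// ltW.
  have : exists n, w n <= u y.
    have [N hN] := exprn_gt_archi (rho / u y) (ltr1n R 2).
    exists N; rewrite /w exprVn ler_pdivrMl ?exprn_gt0//.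
    by move: hN; rewrite ltr_pdivrMr// => /ltW.
  move=> exN; case: (ex_minnP exN) => -[|j] uj jmin.
    by move: uj; rewrite /w expr0 mul1r leNgt ur.
  have ju : u y < w j.
    by rewrite ltNge; apply/negP => /jmin; rewrite ltnn.
  exists j; rewrite /f indicE mem_set ?mule1; last by split.
  rewrite lee_fin.
  have {}uj : 2^-1 * w j <= u y by move: uj; rewrite /w exprS mulrA.
  have [a0|a0] := leP 0 a.
    rewrite (@le_trans _ _ (w j `^ a))// ?ler_peMl ?powR_ge0//.
    by rewrite ge0_ler_powR ?nnegrE ?(ltW u0) ?(ltW (w0 j)) ?(ltW ju).
  rewrite (@le_trans _ _ (2^-1 `^ a * w j `^ a))//; last first.
    by rewrite ler_wpM2r ?powR_ge0// le_max lexx orbT.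
  rewrite -powRM ?(ltW half0) ?(ltW (w0 j))//.
  rewrite -[a]opprK !(powRN _ (- a)) lef_pV2 ?posrE ?powR_gt0 ?mulr_gt0//.
  apply: ge0_ler_powR; rewrite ?nnegrE ?oppr_ge0 ?(ltW a0) ?(ltW u0)//.
  by rewrite mulr_ge0// ltW.
apply: (@le_trans _ _ (\int[mu]_(y in E) \sum_(0 <= j <oo) f j y)%E).
  apply: ge0_le_integral_lower => y Ey; last exact: uf.
  by rewrite lee_fin powR_ge0.
rewrite integral_nneseries//.
have cv : cvgn (fun n => \sum_(0 <= j < n) \int[mu]_(y in E) f j y)%E.
  by apply: is_cvg_nneseries => j _ _; exact: integral_ge0.
suff H n : (\sum_(0 <= j < n) \int[mu]_(y in E) f j y <=
    (c / (1 - q) * A * rho `^ (a + m))%:E)%E.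
  by apply: (lime_le cv); exact: nearW.
(* The j-th term is at most c w_j^a A w_j^m = c A rho^(a+m) q^j, geometric with ratio q = 2^(-(a+m))
   < 1. *)
rewrite (@le_trans _ _ (\sum_(0 <= j < n) (c * A * rho `^ (a + m) * q ^+ j)%:E)%E)//.
  apply: lee_sum => j _; rewrite ge0_integralZl_EFin//; last 2 first.
    by apply: measurable_funTS; apply/measurable_EFinP; exact: measurable_indic.
    by move: (cw0 j); rewrite lee_fin.
  rewrite integral_indic// setIC [X in mu X](_ : _ = F j); last first.
    by rewrite /F setIA setIid.
  rewrite (le_trans (lee_wpmul2l (cw0 j) (layer (w j) _)))//.
    by rewrite w0 wrho.
  rewrite -EFinM lee_fin /q -powR_exprn ?(ltW half0)// -!mulrA ler_wpM2l ?(ltW c0)//.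
  rewrite mulrCA ler_wpM2l// -powRM ?exprn_ge0 ?(ltW half0) ?(ltW rho0)//.
  rewrite [rho * _]mulrC -/(w j) powRD ?lexx//.
  by rewrite (gt_eqF (w0 j)) implybT.
rewrite sumEFin lee_fin -mulr_sumr.
have -> : c / (1 - q) * A * rho `^ (a + m) = c * A * rho `^ (a + m) * (1 - q)^-1.
  by rewrite -!mulrA; congr (_ * _); rewrite mulrC mulrA.
apply: ler_wpM2l; first by rewrite mulr_ge0 ?powR_ge0// mulr_ge0// ltW.
by rewrite big_mkord sum_geometric_le// (ltW q0).
Qed.

(** * Comparison of integrals piece by piece and off a null point *)

Section integral_comparison.
Context (d : measure_display) (T : measurableType d) (R : realType).
Variable mu : {measure set T -> \bar R}.
Implicit Types (D : set T) (f g : T -> R).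

(** By disjointness at most one term of the step function is nonzero at a point, so it lies below f;
    deleting the null point x from each piece does not change the measure. *)
Lemma ge0_integral_lower_sum D f x (N : nat) (S : nat -> set T) (c : nat -> R) :
  measurable [set x] -> mu [set x] = 0%E -> measurable D ->
  (forall y, D y -> 0 <= f y) ->
  (forall k, measurable (S k)) -> (forall k, (k < N)%N -> S k `<=` D) ->
  (forall i j y, (i < N)%N -> (j < N)%N -> S i y -> S j y -> i = j) ->
  (forall k, 0 <= c k) ->
  (forall k y, (k < N)%N -> S k y -> y != x -> c k <= f y) ->
  (\sum_(k < N) (c k)%:E * mu (S k) <= \int[mu]_(y in D) (f y)%:E)%E.
Proof.
move=> mx x0 mD f0 mS SD Sij c0 cf.
pose F k := S k `\` [set x].
have mF k : measurable (F k) by exact: measurableD.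
have muF k : (mu (S k) <= mu (F k))%E.
  rewrite -[leRHS]adde0 -x0; apply: le_trans (measureU2 _ (mF k) mx).
  apply: le_measure; rewrite ?inE//; first exact: measurableU.
  by move=> y Sy; have [->|yx] := pselect (y = x); [right|left].
pose u k y : \bar R := ((c k)%:E * (\1_(F k) y)%:E)%E.
have u0 k y : (0 <= u k y)%E by rewrite mule_ge0// lee_fin.
have mu_ k : measurable_fun D (u k).
  by apply: measurable_funTS; apply/measurable_EFinP; exact: measurable_funM.
apply: (@le_trans _ _ (\int[mu]_(y in D) \sum_(k < N) u k y)%E); last first.
  apply: ge0_le_integral_lower => [y Dy|y Dy]; first exact: sume_ge0.
  have [[j [jN Fj]]|nF] := pselect (exists j, (j < N)%N /\ F j y).
    rewrite (bigD1 (Ordinal jN))//= big1 => [|i ij].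
      rewrite adde0 /u indicE mem_set// mule1 lee_fin.
      by apply: (cf j) => //; case: Fj => // _ /eqP.
    rewrite /u indicE memNset ?mule0// => -[Si _].
    have := Sij _ _ _ (ltn_ord i) jN Si (proj1 Fj).
    by move/eqP: ij => + ijE; apply; apply: val_inj.
  rewrite big1 => [|i _]; first by rewrite lee_fin f0.
  by rewrite /u indicE memNset ?mule0// => Fi; apply: nF; exists i.
rewrite ge0_integral_sum//; apply: lee_sum => k _.
rewrite /u ge0_integralZl_EFin//; last first.
  by apply: measurable_funTS; apply/measurable_EFinP; exact: measurable_indic.
rewrite integral_indic// (_ : F k `&` D = F k); last first.
  by apply/setIidPl => y [Sy _]; exact: SD Sy.
by rewrite lee_wpmul2l ?lee_fin.
Qed.

(** The pieces may overlap: at each point one of the nonnegative terms already dominates f. *)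
Lemma ge0_integral_upper_sum D f (N : nat) (S : nat -> set T) (h : nat -> T -> R) :
  measurable D -> (forall k, measurable (S k)) ->
  (forall k, measurable_fun setT (h k)) -> (forall k y, 0 <= h k y) ->
  (forall y, D y -> 0 <= f y) ->
  (forall y, D y -> exists k, [/\ (k < N)%N, S k y & f y <= h k y]) ->
  (\int[mu]_(y in D) (f y)%:E <= \sum_(k < N) \int[mu]_(y in D `&` S k) (h k y)%:E)%E.
Proof.
move=> mD mS mh h0 f0 fh.
pose u k := ((fun y => (h k y)%:E) \_ (S k)).
have u0 k y : (0 <= u k y)%E by apply: erestrict_ge0 => z _; rewrite lee_fin.
have mu_ k : measurable_fun D (u k).
  apply: measurable_funTS; apply/(measurable_restrictT _ _).1 => //.
  by apply: measurable_funTS; exact/measurable_EFinP.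
apply: (@le_trans _ _ (\int[mu]_(y in D) \sum_(k < N) u k y)%E).
  apply: ge0_le_integral_lower => [y Dy|y Dy]; first by rewrite lee_fin f0.
  have [k [kN Sk fk]] := fh y Dy.
  rewrite (bigD1 (Ordinal kN))//= (@le_trans _ _ (u k y))//.
    by rewrite /u patchE mem_set.
  by rewrite leeDl// sume_ge0.
rewrite ge0_integral_sum//; apply: lee_sum => k _.
by rewrite integral_mkcondr.
Qed.

(** The value of f at x is arbitrary, possibly negative. The function b, equal to |f x| at x and 0
    elsewhere, has integral 0; it dominates the negative part of f, and C g + b dominates the
    positive part. Since g x = 0, the lower bound also holds at x. *)
Lemma integral_asymp_off_point D f g x (C : R) :
  measurable [set x] -> mu [set x] = 0%E -> measurable D -> 0 < C ->
  measurable_fun D g -> (forall y, D y -> 0 <= g y) -> g x = 0 ->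
  (forall y, D y -> y != x -> C^-1 * g y <= f y /\ f y <= C * g y) ->
  (C^-1%:E * \int[mu]_(y in D) (g y)%:E <= \int[mu]_(y in D) (f y)%:E)%E /\
  (\int[mu]_(y in D) (f y)%:E <= C%:E * \int[mu]_(y in D) (g y)%:E)%E.
Proof.
move=> mx x0 mD C0 mg g0 gx fg.
have iC0 : 0 < C^-1 by rewrite invr_gt0.
pose b y : \bar R := (`|f x|%:E * (\1_[set x] y)%:E)%E.
have b0 y : (0 <= b y)%E by rewrite mule_ge0// lee_fin.
have bx : b x = `|f x|%:E by rewrite /b indicE mem_set// mule1.
have mb : measurable_fun D b.
  apply: measurable_funTS; apply/measurable_EFinP; apply: measurable_funM => //.
have intb : (\int[mu]_(y in D) b y)%E = 0%E.
  rewrite ge0_integralZl_EFin//; last first.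
    by apply: measurable_funTS; apply/measurable_EFinP; exact: measurable_indic.
  rewrite integral_indic//; apply/eqP; rewrite mule_eq0; apply/orP; right.
  rewrite eq_le measure_ge0 andbT -x0; apply: le_measure; rewrite ?inE//.
  exact: measurableI.
have mgE : measurable_fun D (fun y => (g y)%:E) by exact/measurable_EFinP.
pose fE y := (f y)%:E.
have fn0 : (\int[mu]_(y in D) (fE^\- y))%E = 0%E.
  apply/eqP; rewrite eq_le; apply/andP; split; last by apply: integral_ge0.
  rewrite -[leRHS]intb; apply: ge0_le_integral_lower => // y Dy.
  rewrite funenegE; have [->|yx] := eqVneq y x.
    by rewrite bx -EFinN ge_max !lee_fin normr_ge0 -normrN ler_norm.
  rewrite ge_max b0 andbT; apply: le_trans (b0 y).
  rewrite -EFinN lee_fin oppr_le0; have [h _] := fg _ Dy yx.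
  by apply: le_trans h; rewrite mulr_ge0 ?(ltW iC0)// g0.
have -> : (\int[mu]_(y in D) (f y)%:E = \int[mu]_(y in D) (fE^\+ y))%E.
  by rewrite [LHS]integralE fn0 sube0.
split.
  rewrite -ge0_integralZl_EFin ?(ltW iC0)//.
  apply: ge0_le_integral_lower => y Dy.
    by rewrite -EFinM lee_fin mulr_ge0 ?(ltW iC0)// g0.
  rewrite funeposE le_max -EFinM; have [->|yx] := eqVneq y x.
    by rewrite gx mulr0 lexx orbT.
  by rewrite lee_fin (proj1 (fg _ Dy yx)).
rewrite -ge0_integralZl_EFin ?(ltW C0)//.
rewrite -[leRHS]adde0 -intb -ge0_integralD//; last 2 first.
  by move=> y Dy; rewrite -EFinM lee_fin mulr_ge0 ?(ltW C0)// g0.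
  by apply/measurable_EFinP; exact: measurable_funM.
apply: ge0_le_integral_lower => // y Dy.
have Cg0 : 0 <= C * g y by rewrite mulr_ge0 ?(ltW C0)// g0.
rewrite funeposE ge_max; apply/andP; split; last by rewrite adde_ge0// -EFinM lee_fin.
have [->|yx] := eqVneq y x.
  by rewrite bx gx mule0 add0e lee_fin ler_norm.
apply: (@le_trans _ _ (C * g y)%:E); first by rewrite lee_fin (proj2 (fg _ Dy yx)).
by rewrite EFinM leeDl.
Qed.

End integral_comparison.

Section powers_gt0.
Context (R : realType).
Implicit Types (a x y r : R).

Lemma gt0_powRD x a b : 0 < x -> x `^ (a + b) = x `^ a * x `^ b.
Proof. by move=> x0; rewrite powRD// (gt_eqF x0) implybT. Qed.

Lemma gt0_powRV x a : 0 < x -> x^-1 `^ a = x `^ (- a).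
Proof. by move=> x0; rewrite -(powR_inv1 (ltW x0)) -powRrM mulN1r. Qed.

Lemma le_powR x y a : 0 <= a -> 0 <= x -> x <= y -> x `^ a <= y `^ a.
Proof. by move=> a0 x0 xy; rewrite ge0_ler_powR// nnegrE// (le_trans x0). Qed.

Lemma le_powRN x y a : 0 <= a -> 0 < x -> x <= y -> y `^ (- a) <= x `^ (- a).
Proof.
move=> a0 x0 xy; have y0 := lt_le_trans x0 xy.
by rewrite !powRN lef_pV2 ?posrE ?powR_gt0// le_powR// ltW.
Qed.

End powers_gt0.

(** * Integrals of the model kernel *)

Section green_bounds.
Context (R : realType) (d : nat) (Omega : set 'rV[R]_d.+1) (s gamma : R).
Hypothesis hOmega : bounded_C11_domain Omega.
Hypothesis s_gt0 : 0 < s.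
Hypothesis gamma_gt0 : 0 < gamma.
Hypothesis s_le : 2 * s <= d.+1%:R.
Implicit Types (x y : 'rV[R]_d.+1).
Local Notation delta := (bdist Omega).
Local Notation G0 := (green_bound Omega s gamma).
Local Notation p := (d.+1%:R - 2 * s).
Let nO : Omega !=set0. Proof. by case: hOmega. Qed.
Let oO : open Omega. Proof. by case: hOmega. Qed.
Let bO : bounded_set Omega. Proof. by case: hOmega. Qed.

Let p0 : 0 <= p. Proof. by rewrite subr_ge0. Qed.

Lemma green_min_ge0 x y :
  0 <= Num.min (delta x * delta y / enorm (x - y) ^+ 2) 1.
Proof. by rewrite le_min ler01 andbT divr_ge0 ?sqr_ge0// mulr_ge0 ?bdist_ge0. Qed.

Lemma green_bound_ge0 x y : 0 <= G0 x y.
Proof. by rewrite mulr_ge0 ?invr_ge0 ?powR_ge0. Qed.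

(** The inverse of 0 is 0, so the minimum vanishes, and its power vanishes because gamma > 0. This
    is the condition on g at x in [integral_asymp_off_point]. *)
Lemma green_bound_diag x : G0 x x = 0.
Proof.
rewrite /green_bound subrr enorm0 expr0n invr0 mulr0 min_l ?ler01//.
by rewrite (@powR0 _ gamma) ?mulr0 ?lt0r_neq0.
Qed.

Lemma measurable_green_bound x : measurable_fun setT (G0 x).
Proof.
have mE : measurable_fun setT (fun y => enorm (x - y)).
  rewrite (_ : (fun y => _) = (fun y => enorm (y - x))); last first.
    by apply/funext => y; rewrite enormBC.
  by apply: continuous_rV_measurable; exact: enorm_sub_continuous.
rewrite (_ : G0 x = fun y => enorm (x - y) `^ (- p) *
    Num.min (delta x * delta y * enorm (x - y) `^ (- 2%:R)) 1 `^ gamma); last first.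
  by apply/funext => y; rewrite /green_bound -powRN powR_invn.
apply: measurable_funM.
  exact: (measurableT_comp (measurable_powR (- p)) mE).
apply: (measurableT_comp (measurable_powR gamma)).
apply: measurable_minr => //.
apply: measurable_funM.
  by apply: measurable_funM => //; exact: (measurable_bdist bO nO oO).
exact: (measurableT_comp (measurable_powR (- 2%:R)) mE).
Qed.

Lemma green_bound_near x y : G0 x y <= enorm (x - y) `^ (2 * s - d.+1%:R).
Proof.
rewrite /green_bound -powRN opprB ler_piMr ?powR_ge0//.
rewrite -[leRHS](_ : 1 `^ gamma = 1); last by rewrite powR1.
by rewrite le_powR ?(ltW gamma_gt0) ?green_min_ge0// ge_min lexx orbT.
Qed.

(** The minimum is bounded by its first entry, which contributes the boundary factors and the extra
    decay 2 gamma; in [green_bound_near] it is bounded by 1. *)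
Lemma green_bound_far x y t : 0 < t -> t / 2 <= enorm (x - y) ->
  G0 x y <= (t / 2) `^ (- (p + 2 * gamma)) * (delta x `^ gamma * delta y `^ gamma).
Proof.
move=> t0 txy; have t20 : 0 < t / 2 by rewrite divr_gt0.
have E0 := lt_le_trans t20 txy.
rewrite /green_bound -powRN [- (p + _)]opprD gt0_powRD// -[leRHS]mulrA.
apply: ler_pM; rewrite ?powR_ge0//; first exact: le_powRN.
rewrite (_ : (t / 2) `^ (- (2 * gamma)) = (((t / 2) ^+ 2)^-1) `^ gamma); last first.
  by rewrite gt0_powRV ?exprn_gt0// -(powR_mulrn 2 (ltW t20)) -powRrM mulrN.
rewrite [leRHS]mulrC -!powRM ?invr_ge0 ?sqr_ge0 ?mulr_ge0 ?bdist_ge0//.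
apply: le_powR; rewrite ?(ltW gamma_gt0) ?green_min_ge0//.
apply: (@le_trans _ _ (delta x * delta y / enorm (x - y) ^+ 2)); first by rewrite ge_min lexx.
rewrite ler_wpM2l ?mulr_ge0 ?bdist_ge0// lef_pV2 ?posrE ?exprn_gt0//.
by rewrite ler_pXn2r ?nnegrE ?(ltW t20).
Qed.

Lemma green_bound_ge x y t q : x != y -> enorm (x - y) <= t -> 0 <= q -> q <= 1 ->
  q <= delta x * delta y / t ^+ 2 -> t `^ (- p) * q `^ gamma <= G0 x y.
Proof.
move=> xy xyt q0 q1 qt.
have E0 : 0 < enorm (x - y) by rewrite lt_def enorm_ge0 enorm_eq0 subr_eq0 xy.
have t0 := lt_le_trans E0 xyt.
rewrite /green_bound -powRN; apply: ler_pM; rewrite ?powR_ge0//; first exact: le_powRN.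
apply: le_powR; rewrite ?(ltW gamma_gt0)// le_min q1 andbT (le_trans qt)//.
rewrite ler_wpM2l ?mulr_ge0 ?bdist_ge0// lef_pV2 ?posrE ?exprn_gt0//.
by rewrite ler_pXn2r ?nnegrE ?(ltW t0).
Qed.

End green_bounds.

(** * Lower bounds for the model integral *)

Section green_integrals.
Context (R : realType) (d : nat) (Omega : set 'rV[R]_d.+1) (s gamma beta : R).
Hypothesis hOmega : bounded_C11_domain Omega.
Hypothesis s_gt0 : 0 < s.
Hypothesis gamma_gt0 : 0 < gamma.
Hypothesis s_le : 2 * s <= d.+1%:R.
Implicit Types (x y : 'rV[R]_d.+1).
Local Notation leb := (lebesgue_rV R d.+1).
Local Notation delta := (bdist Omega).
Local Notation G0 := (green_bound Omega s gamma).
Local Notation p := (d.+1%:R - 2 * s).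
Let nO : Omega !=set0. Proof. by case: hOmega. Qed.
Let oO : open Omega. Proof. by case: hOmega. Qed.
Let bO : bounded_set Omega. Proof. by case: hOmega. Qed.
Let mO : measurable Omega. Proof. exact: measurable_Omega. Qed.

Let p0 : 0 <= p. Proof. by rewrite subr_ge0. Qed.

Definition green_integral x : \bar R :=
  (\int[leb]_(y in Omega) (G0 x y * delta y `^ beta)%:E)%E.

Lemma green_integrand_ge0 x y : 0 <= G0 x y * delta y `^ beta.
Proof. by rewrite mulr_ge0 ?green_bound_ge0 ?powR_ge0. Qed.

Lemma green_integral_ge_sum x (N : nat) (S : nat -> set 'rV[R]_d.+1) (c : nat -> R) :
  (forall k, measurable (S k)) -> (forall k, (k < N)%N -> S k `<=` Omega) ->
  (forall i j y, (i < N)%N -> (j < N)%N -> S i y -> S j y -> i = j) ->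
  (forall k, 0 <= c k) ->
  (forall k y, (k < N)%N -> S k y -> x != y -> c k <= G0 x y * delta y `^ beta) ->
  (\sum_(k < N) (c k)%:E * leb (S k) <= green_integral x)%E.
Proof.
move=> mS SO Sij c0 cG.
apply: (@ge0_integral_lower_sum _ _ _ _ _ _ x) => //.
- exact: rV_set1_measurable.
- exact: lebesgue_rV_set1.
- by move=> y _; exact: green_integrand_ge0.
- by move=> k y kN Sy yx; apply: (cG k) => //; rewrite eq_sym.
Qed.

Lemma green_integral_ge_eball x z t c : 0 < t -> 0 <= c -> eball z t `<=` Omega ->
  (forall y, eball z t y -> x != y -> c <= G0 x y * delta y `^ beta) ->
  ((c * (t / d.+1%:R) ^+ d.+1)%:E <= green_integral x)%E.
Proof.
move=> t0 c0 zO cG.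
have := @green_integral_ge_sum x 1 (fun=> eball z t) (fun=> c).
rewrite big_ord1 => H; apply: le_trans (H _ _ _ _ _) => //.
- by rewrite EFinM lee_wpmul2l ?lee_fin// eball_measure_ge.
- by move=> _; exact: measurable_eball.
- by move=> [|i] [|j].
- by move=> _ y _; exact: cG.
Qed.

(** Only a fixed ball around an interior point z is used; there delta(y) is comparable to delta(z)
    and |x - y| < D. *)
Lemma green_integral_ge_boundary : exists2 C, 0 < C & forall x, Omega x ->
  ((C * delta x `^ gamma)%:E <= green_integral x)%E.
Proof.
have [D D0 [hD hdD]] := Omega_diameter bO nO oO.
have [z Oz] := nO; pose r := delta z; have r0 : 0 < r := bdist_gt0 bO nO oO Oz.
have lo0 : 0 < 2^-1 :> R by rewrite invr_gt0.
have [c c0 hc] := powR_comparable beta 2 lo0.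
have r20 : 0 < r / 2 by rewrite divr_gt0.
(* On the ball delta(y) >= r/2, so delta(x) q is a lower bound for delta(x) delta(y) / D^2; it is at
   most 1 because delta(x) <= D and r <= 2 D. *)
pose q := r / (2 * D ^+ 2); have q0 : 0 < q by rewrite divr_gt0// mulr_gt0// exprn_gt0.
pose k := D `^ (- p) * q `^ gamma * (c^-1 * r `^ beta).
have k0 : 0 < k by rewrite !mulr_gt0 ?powR_gt0 ?invr_gt0.
exists (k * (r / 2 / d.+1%:R) ^+ d.+1); first by rewrite mulr_gt0// exprn_gt0// divr_gt0.
move=> x Ox; have dx0 := bdist_gt0 bO nO oO Ox.
rewrite (mulrAC k).
apply: (@green_integral_ge_eball x z (r / 2) (k * delta x `^ gamma) r20).
- by rewrite mulr_ge0 ?powR_ge0 ?(ltW k0).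
- apply: subset_trans (eball_bdist_sub oO Oz).
  by apply: eball_subset; rewrite subrr enorm0 add0r -/r; lra.
move=> y zy xy.
have Oy : Omega y.
  by apply: (eball_bdist_sub oO Oz); move: zy; rewrite /eball/= -/r; lra.
have [ry yr] : 2^-1 * r <= delta y /\ delta y <= 2 * r.
  have := bdist_lip bO nO oO z y; have := bdist_lip bO nO oO y z.
  by rewrite (enormBC y) -/r; move: zy; rewrite /eball/=; split; lra.
have [hy _] := hc r (delta y) r0 ry yr.
rewrite [leLHS](_ : _ = D `^ (- p) * (delta x * q) `^ gamma * (c^-1 * r `^ beta)); last first.
  rewrite powRM ?(ltW dx0) ?(ltW q0)// /k.
  move: (D `^ _) (q `^ _) (delta x `^ _) (c^-1 * _) => a1 a2 a3 a4; ring.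
apply: ler_pM; rewrite ?mulr_ge0 ?powR_ge0 ?invr_ge0 ?(ltW c0)//.
apply: green_bound_ge => //.
- by rewrite ltW// hD.
- by rewrite mulr_ge0// ltW.
- have hxD := ltW (hdD x Ox); have rD : r <= 2 * D.
    by rewrite (le_trans (ltW (hdD z Oz)))// ler_peMl ?(ltW D0)// ler1n.
  rewrite /q mulrA ler_pdivrMr ?mulr_gt0 ?exprn_gt0// mul1r expr2 mulrCA.
  exact: (ler_pM (ltW dx0) (ltW r0) hxD rD).
- rewrite -mulrA ler_wpM2l ?(ltW dx0)// /q invfM mulrA (mulrC r).
  by rewrite ler_wpM2r ?invr_ge0 ?sqr_ge0.
Qed.

(** On the ball of radius r/2 about x the minimum in the kernel is 1, since delta(x) delta(y) >=
    (r/2)^2. The powers of r from kernel, weight and volume add up to -p + beta + n = beta + 2s. *)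
Lemma green_integral_ge_near : exists2 C, 0 < C & forall x, Omega x ->
  ((C * delta x `^ (beta + 2 * s))%:E <= green_integral x)%E.
Proof.
have lo0 : 0 < 2^-1 :> R by rewrite invr_gt0.
have [c c0 hc] := powR_comparable beta 2 lo0.
exists (2^-1 `^ (- p) * c^-1 * (2^-1 / d.+1%:R) ^+ d.+1).
  by rewrite !mulr_gt0 ?powR_gt0 ?invr_gt0// exprn_gt0// divr_gt0.
move=> x Ox; set r := delta x; have r0 : 0 < r := bdist_gt0 bO nO oO Ox.
have -> : 2^-1 `^ (- p) * c^-1 * (2^-1 / d.+1%:R) ^+ d.+1 * r `^ (beta + 2 * s) =
    (2^-1 * r) `^ (- p) * (c^-1 * r `^ beta) * (2^-1 * r / d.+1%:R) ^+ d.+1.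
  rewrite (mulrAC 2^-1) [(_ * r) ^+ _]exprMn -(powR_mulrn d.+1 (ltW r0)).
  rewrite [(2^-1 * r) `^ _]powRM ?(ltW r0) ?(ltW lo0)//.
  rewrite (_ : beta + 2 * s = - p + beta + d.+1%:R); last by ring.
  rewrite !gt0_powRD//.
  move: (2^-1 `^ _) (r `^ (- p)) (r `^ beta) (r `^ _) ((_ / _) ^+ _) => a1 a2 a3 a4 a5.
  by move: (c^-1) => a6; ring.
have r20 : 0 < 2^-1 * r by rewrite mulr_gt0.
have xO : eball x (2^-1 * r) `<=` Omega.
  apply: subset_trans (eball_bdist_sub oO Ox).
  by apply: eball_subset; rewrite subrr enorm0 add0r -/r; lra.
apply: (@green_integral_ge_eball x x (2^-1 * r) _ r20) => //.
  by rewrite !mulr_ge0 ?powR_ge0 ?invr_ge0 ?(ltW c0).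
move=> y xy xny; have Oy := xO y xy.
have [ry yr] : 2^-1 * r <= delta y /\ delta y <= 2 * r.
  have := bdist_lip bO nO oO x y; have := bdist_lip bO nO oO y x.
  by rewrite (enormBC y) -/r; move: xy; rewrite /eball/=; split; lra.
have [hy _] := hc r (delta y) r0 ry yr.
apply: ler_pM; rewrite ?mulr_ge0 ?powR_ge0 ?invr_ge0 ?(ltW c0)//.
rewrite -[leLHS]mulr1 -[X in _ * X](_ : 1 `^ gamma = 1); last by rewrite powR1.
apply: green_bound_ge => //; first exact: ltW.
rewrite ler_pdivlMr ?exprn_gt0// mul1r -/r expr2 ler_pM ?(ltW r20)//.
by rewrite ler_piMl ?(ltW r0)// invf_le1 ?ler1n.
Qed.

(** At scale tau the ball contributes tau^(-p) (r / tau)^gamma tau^beta tau^n up to constants; for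
    this beta the powers of tau cancel, so each of the N scales gives the same multiple of
    r^gamma. *)
Lemma green_integral_ge_log : beta = gamma - 2 * s ->
  exists r0 C, [/\ 0 < r0, 0 < C & forall x (N : nat), Omega x -> delta x < r0 ->
    4 ^+ N * delta x <= 4 * r0 -> ((N%:R * C * delta x `^ gamma)%:E <= green_integral x)%E].
Proof.
move=> betaE.
have [r0 [K [r00 K1 hcork]]] := corkscrew hOmega.
have K0 : 0 < K by exact: lt_le_trans K1.
have lo0 : 0 < (2 * K)^-1 by rewrite invr_gt0 mulr_gt0.
have [c c0 hc] := powR_comparable beta (3 * K) lo0.
have K30 : 0 < 8 * K ^+ 3 by rewrite mulr_gt0// exprn_gt0.
have K2 : 0 < 2 * K by rewrite mulr_gt0.
pose C := (2 * K) `^ (- p) * (8 * K ^+ 3) `^ (- gamma) * c^-1 * ((2 * K)^-1 / d.+1%:R) ^+ d.+1.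
have C0 : 0 < C.
  by rewrite !mulr_gt0 ?powR_gt0 ?invr_gt0// exprn_gt0// divr_gt0.
exists r0, C; split => // x N Ox xr0 xN.
set r := delta x; have rgt0 : 0 < r := bdist_gt0 bO nO oO Ox.
have [v [h hv]] := hcork x Ox xr0.
pose tau (k : nat) := 4 ^+ k * r.
have tau0 k : 0 < tau k by rewrite mulr_gt0// exprn_gt0.
have rtau k : r <= tau k by rewrite ler_peMl ?(ltW rgt0)// exprn_ege1// ler1n.
have taur0 k : (k < N)%N -> 0 < tau k <= r0.
  move=> kN; rewrite tau0/=; have : tau k.+1 <= 4 * r0.
    by apply: le_trans xN; rewrite ler_wpM2r ?(ltW rgt0)// ler_weXn2l// ler1n.
  by rewrite /tau exprS -mulrA ler_pM2l.
pose S k := eball (x + tau k *: v) (tau k / (2 * K)).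
(* From delta(y) >= tau / (2K) and |x - y| <= 2 K tau: r (tau / (2K)) / (2 K tau)^2 = r / (8 K^3
   tau). *)
pose q k := r / (8 * K ^+ 3 * tau k).
have q0 k : 0 < q k by rewrite divr_gt0// mulr_gt0.
pose ck k := (2 * K * tau k) `^ (- p) * q k `^ gamma * (c^-1 * tau k `^ beta).
have ck0 k : 0 <= ck k by rewrite !mulr_ge0 ?powR_ge0 ?invr_ge0 ?(ltW c0).
have mS k : measurable (S k) by exact: measurable_eball.
have SO k : (k < N)%N -> S k `<=` Omega.
  by move=> /taur0 tk y /(hv _ _ tk)[].
apply: le_trans (@green_integral_ge_sum x N S ck mS SO _ ck0 _).
- have ckS k : ((C * r `^ gamma)%:E <= (ck k)%:E * leb (S k))%E.
    have tK0 : 0 < tau k / (2 * K) by rewrite divr_gt0.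
    apply: (@le_trans _ _
      ((ck k)%:E * ((tau k / (2 * K) / d.+1%:R) ^+ d.+1)%:E)%E); last first.
      by rewrite lee_wpmul2l ?lee_fin// eball_measure_ge.
    rewrite -EFinM lee_fin le_eqVlt; apply/orP; left; apply/eqP.
    have Kt0 : 0 < 8 * K ^+ 3 * tau k by rewrite mulr_gt0.
    rewrite /ck /C /q [(2 * K * tau k) `^ _]powRM ?(ltW K2) ?(ltW (tau0 k))//.
    rewrite [(r / _) `^ _]powRM ?(ltW rgt0) ?invr_ge0 ?(ltW Kt0)//.
    rewrite gt0_powRV// [(8 * _ * _) `^ _]powRM ?(ltW K30) ?(ltW (tau0 k))//.
    rewrite -(mulrA (tau k)) [(tau k * _) ^+ _]exprMn -(powR_mulrn d.+1 (ltW (tau0 k))).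
    have E : tau k `^ (- p) * tau k `^ (- gamma) * tau k `^ beta * tau k `^ d.+1%:R = 1.
      rewrite -!gt0_powRD// (_ : - p + - gamma + beta + d.+1%:R = 0) ?powRr0//.
      by rewrite betaE; ring.
    rewrite -[LHS]mulr1 -[X in _ * X = _]E.
    move: ((2 * K) `^ _) ((8 * K ^+ 3) `^ _) (c^-1) ((_ / _) ^+ _) => a1 a2 a3 a4.
    move: (r `^ _) (tau k `^ _) (tau k `^ _) (tau k `^ _) => b1 b2 b3 b4.
    ring.
  apply: (@le_trans _ _ (\sum_(k < N) (C * r `^ gamma)%:E)%E).
    by rewrite -mulrA EFinM sumr_const card_ord mule_natl.
  by apply: lee_sum => k _; exact: ckS.
- move=> i j y iN jN Si Sj.
  have [_ _ _ /andP[i1 i2]] := hv _ _ (taur0 i iN) Si.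
  have [_ _ _ /andP[j1 j2]] := hv _ _ (taur0 j jN) Sj.
  (* Heights at scale tau lie between tau / 2 and 3 tau / 2; the ratio 4 between scales separates
     these ranges. *)
  have tlt a b : (a < b)%N -> 4 * tau a <= tau b.
    by move=> ab; rewrite /tau mulrA -exprS ler_wpM2r ?(ltW rgt0)// ler_weXn2l// ler1n.
  have ti := tau0 i; have tj := tau0 j.
  case: (ltngtP i j) => // [/tlt|/tlt] h1; exfalso; move: i1 i2 j1 j2 h1 ti tj; lra.
- move=> k y kN Sy xy; have tk := taur0 k kN.
  have [Oy dy xyt _] := hv _ _ tk Sy.
  have tk0 := tau0 k; have rk := rtau k.
  have dy' : (2 * K)^-1 * tau k <= delta y by rewrite mulrC.
  have yd : delta y <= 3 * K * tau k.
    have := bdist_lip bO nO oO y x; rewrite enormBC -/r => dyx.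
    rewrite (le_trans dyx)// (_ : 3 * K * tau k = K * tau k + 2 * K * tau k); last by ring.
    by rewrite lerD// (le_trans rk)// ler_peMl// ltW.
  have [hy _] := hc (tau k) (delta y) tk0 dy' yd.
  apply: ler_pM; rewrite ?mulr_ge0 ?powR_ge0 ?invr_ge0 ?(ltW c0)//.
  have Kt0 : 0 < 8 * K ^+ 3 * tau k by rewrite mulr_gt0.
  apply: green_bound_ge => //; first exact: ltW.
    rewrite ler_pdivrMr// mul1r (le_trans rk)// ler_peMl ?(ltW tk0)//.
    by rewrite mulr_ege1 ?ler1n ?exprn_ege1.
  rewrite -/r (le_trans _ (_ : r * (tau k / (2 * K)) / (2 * K * tau k) ^+ 2 <= _))//.
    rewrite le_eqVlt; apply/orP; left; apply/eqP; rewrite /q.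
    by field; rewrite !gt_eqF.
  by rewrite ler_wpM2r ?invr_ge0 ?sqr_ge0// ler_wpM2l// ltW.
Qed.

End green_integrals.

(** * Weighted integrability and the upper bound by shells *)

Section upper_estimates.
Context (R : realType) (d : nat) (Omega : set 'rV[R]_d.+1) (s gamma beta : R).
Hypothesis hOmega : bounded_C11_domain Omega.
Hypothesis s_gt0 : 0 < s.
Hypothesis gamma_gt0 : 0 < gamma.
Hypothesis s_le : 2 * s <= d.+1%:R.
Hypothesis beta_gamma : -1 < beta + gamma.
Implicit Types (x y : 'rV[R]_d.+1).
Local Notation leb := (lebesgue_rV R d.+1).
Local Notation delta := (bdist Omega).
Local Notation G0 := (green_bound Omega s gamma).
Local Notation p := (d.+1%:R - 2 * s).
Local Notation e := (beta + 2 * s - gamma).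
Local Notation I := (green_integral Omega s gamma beta).
Let nO : Omega !=set0. Proof. by case: hOmega. Qed.
Let oO : open Omega. Proof. by case: hOmega. Qed.
Let bO : bounded_set Omega. Proof. by case: hOmega. Qed.
Let mO : measurable Omega. Proof. exact: measurable_Omega. Qed.
Let mdelta : measurable_fun setT (delta : 'rV[R]_d.+1 -> measurableTypeR R).
Proof. exact: measurable_bdist. Qed.

(** [dyadic_integral] with u = delta and m = 1. Since delta(x) <= t, delta is below 2t on the ball;
    the ball is enlarged to radius 2t so that [layer_measure] covers all thicknesses up to 2t. *)
Lemma bdist_integral (a T : R) : -1 < a -> exists2 C, 0 < C &
  forall x t (S : set 'rV[R]_d.+1), Omega x -> delta x <= t -> t <= T ->
    measurable S -> S `<=` Omega `&` eball x t ->
    (\int[leb]_(y in S) (delta y `^ a)%:E <= (C * t `^ (a + d.+1%:R))%:E)%E.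
Proof.
move=> a1; have a10 : 0 < a + 1 by rewrite -ltrBlDr sub0r.
have [C1 C10 H1] := dyadic_integral leb a10.
have [C2 C20 H2] := layer_measure hOmega (2 * T).
exists (C1 * C2 * 2 `^ (a + d.+1%:R)); first by rewrite !mulr_gt0 ?powR_gt0.
move=> x t S Ox xt tT mS SO.
have t0 : 0 < t by apply: lt_le_trans xt; exact: bdist_gt0.
have t20 : 0 < 2 * t by rewrite mulr_gt0.
have -> : C1 * C2 * 2 `^ (a + d.+1%:R) * t `^ (a + d.+1%:R) =
    C1 * (C2 * (2 * t) ^+ d) * (2 * t) `^ (a + 1).
  rewrite -(powR_mulrn d (ltW t20)) -!mulrA -powRM ?(ltW t0)//.
  rewrite (_ : a + d.+1%:R = d%:R + (a + 1)); last by rewrite -nat1r; ring.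
  by rewrite [in LHS]gt0_powRD.
apply: H1 => //.
- by rewrite mulr_ge0 ?exprn_ge0 ?(ltW C20) ?(ltW t20).
- move=> y /SO[_ xy]; rewrite bdist_ge0/=.
  rewrite (le_lt_trans (bdist_lip bO nO oO y x))// enormBC mulr_natl mulr2n.
  exact: (ler_ltD xt xy).
- move=> f /andP[f0 ft]; rewrite powRr1 ?(ltW f0)//.
  rewrite mulrAC; apply: le_trans (H2 x f (2 * t) f0 ft _); last by rewrite ler_pM2l.
  have mf : measurable [set y | delta y < f].
    rewrite [X in measurable X](_ : _ = setT `&` delta @^-1` `]-oo, f[%classic).
      exact: mdelta.
    by apply/seteqP; split => y; rewrite /= in_itv/= => // -[].
  apply: le_measure; rewrite ?inE.
  + exact: measurableI.
  + by apply: measurableI => //; apply: measurableI => //; exact: measurable_eball.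
  + move=> y [/SO[Oy xy] yf]; split => //; split => //.
    by rewrite /eball/= (lt_le_trans xy)// ler_peMl ?(ltW t0)// ler1n.
Qed.

Lemma weighted_L1_bdist : weighted_L1 Omega gamma (fun x => delta x `^ beta).
Proof.
have [D D0 [hD hdD]] := Omega_diameter bO nO oO.
have [x Ox] := nO.
have [C C0 hC] := bdist_integral D beta_gamma.
split.
  move=> Y mY; exists (Omega `&` (fun y => delta y `^ beta) @^-1` Y).
    by apply: (measurable_funTS (measurableT_comp (measurable_powR beta) mdelta)).
  by rewrite setDv setU0; exact: negligible_set0.
rewrite (@le_lt_trans _ _ (C * D `^ (beta + gamma + d.+1%:R))%:E) ?ltry//.
apply: le_trans (hC x D Omega Ox _ _ mO _) => //.
- rewrite le_eqVlt; apply/orP; left; apply/eqP; apply: eq_integral => y /set_mem Oy.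
  rewrite ger0_norm ?mulr_ge0 ?powR_ge0// gt0_powRD//; exact: bdist_gt0.
- by rewrite ltW// hdD.
- by move=> y Oy; split => //; rewrite /eball/= hD.
Qed.

(* [h x r c k] bounds the integrand on the shell [S x r k]; the index 0 stands
   for the ball |x - y| < r/2, on which delta(y)^beta <= c r^beta. *)
Let h x (r c : R) (k : nat) y : R := if k is k'.+1
  then (2 ^+ k' * r / 2) `^ (- (p + 2 * gamma)) * r `^ gamma * delta y `^ (beta + gamma)
  else c * r `^ beta * enorm (x - y) `^ (2 * s - d.+1%:R).

Let S x (r : R) (k : nat) : set 'rV[R]_d.+1 := if k is k'.+1
  then eball x (2 ^+ k' * r) `\` eball x (2 ^+ k' * r / 2) else eball x (r / 2).

(** A shell of scale t contributes delta(x)^gamma t^e. The inner ball contributes delta(x)^(beta +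
    2s) = delta(x)^gamma delta(x)^e, of the same form as the shell k = 0. *)
Lemma green_integral_le_shells (D : R) : exists2 C, 0 < C & forall x (N : nat),
  Omega x -> (forall y, Omega y -> enorm (x - y) < 2 ^+ N * delta x) ->
  2 ^+ N * delta x <= D ->
  (I x <= (C * (delta x `^ gamma * \sum_(k < N.+1) (2 ^+ k * delta x) `^ e))%:E)%E.
Proof.
have [Cb Cb0 hCb] := bdist_integral D beta_gamma.
have am0 : 0 < 2 * s - d.+1%:R + d.+1%:R by rewrite subrK mulr_gt0.
have [Cn Cn0 hCn] := dyadic_integral leb am0.
have lo0 : 0 < 2^-1 :> R by rewrite invr_gt0.
have [c c0 hc] := powR_comparable beta 2 lo0.
pose C1 := c * Cn * 2 ^+ d.+1 * 2^-1 `^ (2 * s).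
pose C2 := 2^-1 `^ (- (p + 2 * gamma)) * Cb.
have C10 : 0 < C1 by rewrite !mulr_gt0 ?powR_gt0 ?exprn_gt0.
have C20 : 0 < C2 by rewrite mulr_gt0 ?powR_gt0.
exists (C1 + C2); first by rewrite addr_gt0.
move=> x N Ox hN ND; set r := delta x; have r0 : 0 < r := bdist_gt0 bO nO oO Ox.
pose t (k : nat) := 2 ^+ k * r.
have t0 k : 0 < t k by rewrite mulr_gt0// exprn_gt0.
have rt k : r <= t k by rewrite ler_peMl ?(ltW r0)// exprn_ege1// ler1n.
have tD k : (k < N.+1)%N -> t k <= D.
  move=> kN; apply: le_trans ND; rewrite ler_wpM2r ?(ltW r0)//.
  by rewrite ler_weXn2l// ler1n.
have mS k : measurable (S x r k).
  by case: k => [|k]; [|apply: measurableD]; exact: measurable_eball.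
have mE : measurable_fun setT (fun y => enorm (x - y) : measurableTypeR R).
  rewrite (_ : (fun y => _) = (fun y => enorm (y - x))); last first.
    by apply/funext => y; rewrite enormBC.
  by apply: continuous_rV_measurable; exact: enorm_sub_continuous.
have mEa a : measurable_fun setT (fun y => enorm (x - y) `^ a).
  exact: (measurableT_comp (measurable_powR a) mE).
have mda a : measurable_fun setT (fun y => delta y `^ a).
  exact: (measurableT_comp (measurable_powR a) mdelta).
have mh k : measurable_fun setT (h x r c k).
  by case: k => [|k]; apply: measurable_funM.
have h0 k y : 0 <= h x r c k y.
  by case: k => [|k]; rewrite /h !mulr_ge0 ?powR_ge0 ?(ltW c0).
apply: (@le_trans _ _ (\sum_(k < N.+2) \int[leb]_(y in Omega `&` S x r k) (h x r c k y)%:E)%E).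
  apply: ge0_integral_upper_sum => // y Oy; first exact: green_integrand_ge0.
  have dy := bdist_gt0 bO nO oO Oy.
  have [xy|xy] := ltP (enorm (x - y)) (r / 2).
    exists 0%N; split => //=.
    have [ry yr] : 2^-1 * r <= delta y /\ delta y <= 2 * r.
      have := bdist_lip bO nO oO x y; have := bdist_lip bO nO oO y x.
      by rewrite (enormBC y) -/r; move: xy; split; lra.
    have [_ hy] := hc r (delta y) r0 ry yr.
    rewrite mulrC; apply: ler_pM; rewrite ?powR_ge0 ?green_bound_ge0//.
    exact: green_bound_near.
  (* The least k with |x - y| < t k gives t k / 2 <= |x - y|; for k = 0 this is the assumption r/2
     <= |x - y|. The shell of scale t k carries the index k + 1. *)
  have exk : exists k, enorm (x - y) < t k by exists N; exact: hN.
  case: (ex_minnP exk) => k xyk kmin.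
  have kN : (k <= N)%N by apply: kmin; exact: hN.
  have tk : t k / 2 <= enorm (x - y).
    case: k xyk kmin kN => [_ _ _|k _ kmin _]; first by rewrite /t expr0 mul1r.
    rewrite leNgt; apply/negP => H; have := kmin k; rewrite ltnn.
    move=> /(_ _)/negP; apply; last by [].
    suff <- : t k.+1 / 2 = t k by [].
    by rewrite /t exprS; field.
  exists k.+1; split => //.
    by split => //=; apply/negP; rewrite -leNgt.
  apply: le_trans (ler_wpM2r (powR_ge0 _ _) (green_bound_far _ _ _ (t0 k) tk)) _ => //.
  rewrite /= -/(t k) gt0_powRD// -!mulrA ler_wpM2l ?powR_ge0//.
  by rewrite ler_wpM2l ?powR_ge0// mulrC.
have near_le : (\int[leb]_(y in Omega `&` S x r 0) (h x r c 0 y)%:E <=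
    (C1 * (r `^ gamma * r `^ e))%:E)%E.
  have mOS : measurable (Omega `&` S x r 0) by exact: measurableI.
  under eq_integral do rewrite /= EFinM.
  rewrite ge0_integralZl_EFin//; last 3 first.
  - by move=> y _; rewrite lee_fin powR_ge0.
  - by apply: measurable_funTS; exact/measurable_EFinP.
  - by rewrite mulr_ge0 ?powR_ge0 ?(ltW c0).
  have r20 : 0 < 2^-1 * r by rewrite mulr_gt0.
  have -> : C1 * (r `^ gamma * r `^ e) =
      c * r `^ beta * (Cn * 2 ^+ d.+1 * (2^-1 * r) `^ (2 * s - d.+1%:R + d.+1%:R)).
    rewrite subrK -gt0_powRD// (_ : gamma + e = beta + 2 * s); last by ring.
    rewrite gt0_powRD// powRM ?(ltW r0) ?(ltW lo0)// /C1.
    move: (r `^ _) (r `^ _) (2^-1 `^ _) (2 ^+ _) => a1 a2 a3 a4; ring.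
  rewrite [leRHS]EFinM lee_wpmul2l ?lee_fin ?mulr_ge0 ?powR_ge0 ?(ltW c0)//.
  (* Layer cake in u = |x - y| with a = 2s - n and m = n, the growth exponent of the volume of
     balls; a + m = 2s is positive. *)
  apply: hCn => //.
  - by move=> y [_] /=; rewrite enorm_ge0 mulrC.
  move=> f /andP[f0 fr]; apply: (@le_trans _ _ (leb (eball x f))).
    apply: le_measure; rewrite ?inE; last by move=> y [_].
      apply: measurableI => //; exact: measurable_eball.
    exact: measurable_eball.
  apply: (le_trans (eball_measure_le _ (ltW f0))).
  by rewrite powR_mulrn ?(ltW f0)// exprMn.
have far_le k : (k < N.+1)%N ->
    (\int[leb]_(y in Omega `&` S x r k.+1) (h x r c k.+1 y)%:E <=
    (C2 * (r `^ gamma * t k `^ e))%:E)%E.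
  move=> kN; have mOS : measurable (Omega `&` S x r k.+1) by exact: measurableI.
  under eq_integral do rewrite /= EFinM.
  rewrite ge0_integralZl_EFin//; last 3 first.
  - by move=> y _; rewrite lee_fin powR_ge0.
  - by apply: measurable_funTS; exact/measurable_EFinP.
  - by rewrite mulr_ge0 ?powR_ge0.
  have -> : C2 * (r `^ gamma * t k `^ e) = (t k / 2) `^ (- (p + 2 * gamma)) * r `^ gamma *
      (Cb * t k `^ (beta + gamma + d.+1%:R)).
    rewrite (mulrC (t k)) [(2^-1 * t k) `^ _]powRM ?(ltW (t0 k)) ?(ltW lo0)// /C2.
    rewrite (_ : e = - (p + 2 * gamma) + (beta + gamma + d.+1%:R)); last by ring.
    rewrite (gt0_powRD (- (p + 2 * gamma)) _ (t0 k)).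
    move: (r `^ _) (t k `^ _) (t k `^ _) (2^-1 `^ _) => a1 a2 a3 a4; ring.
  rewrite [leRHS]EFinM lee_wpmul2l ?lee_fin ?mulr_ge0 ?powR_ge0//.
  apply: (hCb x) => //; first exact: tD.
  by move=> y [Oy [xy _]].
rewrite big_ord_recl.
apply: (@le_trans _ _ ((C1 * (r `^ gamma * r `^ e))%:E +
    \sum_(k < N.+1) (C2 * (r `^ gamma * t k `^ e))%:E)%E).
  by apply: leeD => //; apply: lee_sum => k _; exact: far_le.
(* The inner ball is absorbed into the term k = 0 of the sum. *)
rewrite sumEFin -EFinD lee_fin -mulr_sumr -mulr_sumr [leRHS]mulrDl lerD2r.
rewrite ler_wpM2l ?(ltW C10)// ler_wpM2l ?powR_ge0//.
rewrite big_ord_recl /= expr0 mul1r lerDl sumr_ge0// => k _.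
exact: powR_ge0.
Qed.

End upper_estimates.

(** * Sums over dyadic scales *)

Section scales.
Context (R : realType).
Implicit Types (q r D e : R).

Lemma exists_scale q r D : 1 < q -> 0 < r -> r <= D ->
  exists N : nat, D < q ^+ N * r /\ q ^+ N * r <= q * D.
Proof.
move=> q1 r0 rD; have q0 : 0 < q by rewrite (lt_trans ltr01).
have exN : exists N, D < q ^+ N * r.
  have [N hN] := exprn_gt_archi (D / r) q1.
  by exists N; rewrite -ltr_pdivrMr.
case: (ex_minnP exN) => -[|N] hN Nmin; first by move: hN; rewrite expr0 mul1r ltNge rD.
exists N.+1; split => //; rewrite exprS -mulrA ler_pM2l// leNgt; apply/negP => /Nmin.
by rewrite ltnn.
Qed.

Lemma sum_scales_lt0 e : e < 0 -> exists2 C, 0 < C & forall r (N : nat), 0 < r ->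
  \sum_(k < N) (2 ^+ k * r) `^ e <= C * r `^ e.
Proof.
move=> e0; pose q : R := 2 `^ e.
have q0 : 0 < q by exact: powR_gt0.
have q1 : q < 1.
  rewrite /q -[e]opprK powRN invf_lt1 ?powR_gt0//.
  have ne0 : 0 < - e by rewrite oppr_gt0.
  have := gt0_ltr_powR ne0 _ _ (ltr1n R 2); rewrite powR1; apply; by rewrite nnegrE.
exists ((1 - q)^-1) => [|r N r0]; first by rewrite invr_gt0 subr_gt0.
under eq_bigr do rewrite powRM ?exprn_ge0 ?(ltW r0)// powR_exprn//.
by rewrite -mulr_suml ler_wpM2r ?powR_ge0// sum_geometric_le// (ltW q0).
Qed.

(** Read from the largest scale downwards, the sum is one with exponent -e starting at the inverse
    of 2^N r, to which [sum_scales_lt0] applies. *)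
Lemma sum_scales_gt0 e : 0 < e -> exists2 C, 0 < C & forall r (N : nat), 0 < r ->
  \sum_(k < N.+1) (2 ^+ k * r) `^ e <= C * (2 ^+ N * r) `^ e.
Proof.
move=> e0; have ne0 : - e < 0 by rewrite oppr_lt0.
have [C C0 hC] := sum_scales_lt0 ne0; exists C => // r N r0.
have t0 : 0 < 2 ^+ N * r by rewrite mulr_gt0// exprn_gt0.
have it0 : 0 < (2 ^+ N * r)^-1 by rewrite invr_gt0.
rewrite (reindex_inj rev_ord_inj)/=.
rewrite (_ : (2 ^+ N * r) `^ e = (2 ^+ N * r)^-1 `^ (- e)); last by rewrite gt0_powRV// opprK.
apply: le_trans (hC _ N.+1 it0); apply: ler_sum => k _.
rewrite le_eqVlt; apply/orP; left; apply/eqP.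
rewrite -gt0_powRV ?mulr_gt0 ?exprn_gt0//; congr (_ `^ _).
rewrite subSS; have kN : (k <= N)%N by rewrite -ltnS.
have -> : 2 ^+ N = 2 ^+ (N - k) * 2 ^+ k :> R by rewrite -exprD subnK.
by field; rewrite !gt_eqF ?exprn_gt0.
Qed.

End scales.

(** * The three regimes and the transfer to the Green operator *)

Section asymptotics.
Context (R : realType) (d : nat) (Omega : set 'rV[R]_d.+1) (s gamma beta : R).
Hypothesis hOmega : bounded_C11_domain Omega.
Hypothesis s_gt0 : 0 < s.
Hypothesis gamma_gt0 : 0 < gamma.
Hypothesis s_le : 2 * s <= d.+1%:R.
Hypothesis beta_gamma : -1 < beta + gamma.
Implicit Types (x y : 'rV[R]_d.+1).
Local Notation delta := (bdist Omega).
Local Notation I := (green_integral Omega s gamma beta).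
Let nO : Omega !=set0. Proof. by case: hOmega. Qed.
Let oO : open Omega. Proof. by case: hOmega. Qed.
Let bO : bounded_set Omega. Proof. by case: hOmega. Qed.

(** N is such that 2^N delta(x) passes the diameter bound D, so the shells cover [Omega], but stays
    below 2D, which keeps the constants independent of x. *)
Lemma green_integral_le_scales : exists D C, [/\ 0 < D, 0 < C,
  forall x, Omega x -> delta x <= D & forall x, Omega x ->
  exists N : nat, [/\ D < 2 ^+ N * delta x, 2 ^+ N * delta x <= 2 * D &
    (I x <= (C * (delta x `^ gamma *
      \sum_(k < N.+1) (2 ^+ k * delta x) `^ (beta + 2 * s - gamma)))%:E)%E]].
Proof.
have [D D0 [hD hdD]] := Omega_diameter bO nO oO.
have [C C0 hC] := green_integral_le_shells hOmega s_gt0 gamma_gt0 s_le beta_gamma (2 * D).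
exists D, C; split => // [x Ox|x Ox]; first exact/ltW/hdD.
have dx0 := bdist_gt0 bO nO oO Ox.
have [N [DN ND]] := exists_scale (ltr1n R 2) dx0 (ltW (hdD x Ox)).
exists N; split => //; apply: hC => // y Oy; exact: lt_trans (hD x y Ox Oy) DN.
Qed.

(** The smallest scale delta(x) dominates the sum. *)
Lemma green_integral_le_lt : beta < gamma - 2 * s -> exists2 C, 0 < C &
  forall x, Omega x -> (I x <= (C * delta x `^ (beta + 2 * s))%:E)%E.
Proof.
move=> b; have e0 : beta + 2 * s - gamma < 0 by rewrite subr_lt0 -ltrBrDr.
have [D [C [D0 C0 _ hC]]] := green_integral_le_scales.
have [C1 C10 hC1] := sum_scales_lt0 e0.
exists (C * C1) => [|x Ox]; first exact: mulr_gt0.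
have dx0 := bdist_gt0 bO nO oO Ox.
have [N [_ _ hN]] := hC x Ox; apply: (le_trans hN).
rewrite lee_fin -mulrA ler_wpM2l ?(ltW C0)//.
apply: le_trans (ler_wpM2l (powR_ge0 _ _) (hC1 _ N.+1 dx0)) _.
rewrite mulrCA ler_wpM2l ?(ltW C10)// -gt0_powRD//.
by rewrite (_ : gamma + _ = beta + 2 * s)//; ring.
Qed.

(** Every term of the sum is 1, leaving N + 1; the logarithm of 2^N delta(x) <= 2D bounds N. *)
Lemma green_integral_le_eq : beta = gamma - 2 * s -> exists2 C, 0 < C &
  forall x, Omega x -> (I x <= (C * (delta x `^ gamma * (1 + `|ln (delta x)|)))%:E)%E.
Proof.
move=> b; have e0 : beta + 2 * s - gamma = 0 by rewrite b; ring.
have [D [C [D0 C0 _ hC]]] := green_integral_le_scales.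
have l2 : 0 < ln 2 :> R by rewrite ln_gt0// ltr1n.
(* In K the 1 pays for the extra term of N + 1, the quotient for N, as A + L <= (1 + A)(1 + L) with
   L = |ln delta(x)|. *)
pose A := `|ln (2 * D)|; pose K := 1 + (1 + A) / ln 2.
have A0 : 0 <= A by exact: normr_ge0.
have K0 : 0 < K by rewrite ltr_pwDl// divr_ge0 ?addr_ge0 ?(ltW l2).
exists (C * K) => [|x Ox]; first exact: mulr_gt0.
have dx0 := bdist_gt0 bO nO oO Ox.
have [N [_ ND hN]] := hC x Ox; apply: (le_trans hN).
rewrite lee_fin -mulrA ler_wpM2l ?(ltW C0)// mulrCA ler_wpM2l ?powR_ge0//.
under eq_bigr do rewrite e0 powRr0.
rewrite sumr_const card_ord.
have : N%:R * ln 2 + ln (delta x) <= ln (2 * D).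
  rewrite mulr_natl -lnXn// -lnM ?posrE ?exprn_gt0//.
  by rewrite ler_ln ?posrE ?mulr_gt0 ?exprn_gt0.
have := ler_norm (ln (2 * D)); have := ler_norm (- ln (delta x)).
rewrite normrN -/A; set L := `|ln (delta x)| => h1 h2 h3.
have L0 : 0 <= L by exact: normr_ge0.
have NL : N%:R <= (A + L) / ln 2 by rewrite ler_pdivlMr//; lra.
have : (A + L) / ln 2 <= (1 + A) / ln 2 * (1 + L).
  rewrite mulrAC ler_wpM2r ?invr_ge0 ?(ltW l2)//.
  have : 0 <= A * L by exact: mulr_ge0.
  by rewrite mulrDr mulr1 mulrDl mul1r; lra.
by move=> h4; rewrite /K [leRHS]mulrDl mul1r -nat1r; move: h4 NL L0; lra.
Qed.

(** The largest scale, at most 2D, dominates the sum. *)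
Lemma green_integral_le_gt : gamma - 2 * s < beta -> exists2 C, 0 < C &
  forall x, Omega x -> (I x <= (C * delta x `^ gamma)%:E)%E.
Proof.
move=> b; have e0 : 0 < beta + 2 * s - gamma by rewrite subr_gt0 -ltrBlDr.
have [D [C [D0 C0 _ hC]]] := green_integral_le_scales.
have [C1 C10 hC1] := sum_scales_gt0 e0.
exists (C * (C1 * (2 * D) `^ (beta + 2 * s - gamma))) => [|x Ox].
  by rewrite !mulr_gt0// powR_gt0// mulr_gt0.
have dx0 := bdist_gt0 bO nO oO Ox.
have [N [_ ND hN]] := hC x Ox; apply: (le_trans hN).
rewrite lee_fin -[leRHS]mulrA ler_wpM2l ?(ltW C0)// mulrC ler_wpM2r ?powR_ge0//.
apply: (le_trans (hC1 _ N dx0)); rewrite ler_wpM2l ?(ltW C10)//.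
by rewrite le_powR ?(ltW e0)// mulr_ge0 ?exprn_ge0 ?(ltW dx0).
Qed.

(** The N scales account for |ln delta(x)| up to a bounded error A, and the fixed ball of
    [green_integral_ge_boundary] pays for 1 + A. *)
Lemma green_integral_ge_eq : beta = gamma - 2 * s -> exists2 C, 0 < C &
  forall x, Omega x -> ((C * (delta x `^ gamma * (1 + `|ln (delta x)|)))%:E <= I x)%E.
Proof.
move=> b.
have [r0 [k [r00 k0 hk]]] := green_integral_ge_log hOmega gamma_gt0 s_le b.
have [c c0 hc] := green_integral_ge_boundary beta hOmega gamma_gt0 s_le.
have [D [_ [D0 _ hD _]]] := green_integral_le_scales.
pose A := `|ln r0| + `|ln D|; have A0 : 0 <= A by rewrite addr_ge0.
have l4 : 0 < ln 4 :> R by rewrite ln_gt0// ltr1n.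
have IN x : Omega x -> exists N : nat, `|ln (delta x)| <= N%:R * ln 4 + A /\
    ((N%:R * k * delta x `^ gamma)%:E <= I x)%E.
  move=> Ox; have dx0 := bdist_gt0 bO nO oO Ox.
  have lD : ln (delta x) <= `|ln D|.
    by rewrite (le_trans _ (ler_norm _))// ler_ln ?posrE// hD.
  have lr := ler_norm (- ln r0); rewrite normrN in lr.
  have lr0 : 0 <= `|ln r0| by []. have lD0 : 0 <= `|ln D| by [].
  (* For delta(x) >= r0 no scale is used: N = 0, and ln delta(x) lies between ln r0 and ln D. *)
  have [rx|xr] := leP r0 (delta x).
    exists 0%N; rewrite !mul0r; split.
      have : ln r0 <= ln (delta x) by rewrite ler_ln.
      by rewrite ler_norml /A => ?; apply/andP; split; lra.
    by apply: integral_ge0 => y _; rewrite lee_fin green_integrand_ge0.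
  have [N [rN Nr]] := exists_scale (ltr1n R 4) dx0 (ltW xr).
  exists N; split; last exact: hk.
  have : ln r0 < N%:R * ln 4 + ln (delta x).
    rewrite mulr_natl -lnXn// -lnM ?posrE ?exprn_gt0//.
    by rewrite ltr_ln ?posrE ?mulr_gt0 ?exprn_gt0.
  have NL0 : 0 <= N%:R * ln 4 :> R by rewrite mulr_ge0// ltW.
  by rewrite ler_norml /A => ?; apply/andP; split; lra.
have A10 : 0 < 1 + A by rewrite ltr_pwDl.
pose c1 := c / (1 + A); pose c2 := k / ln 4.
have c10 : 0 < c1 by exact: divr_gt0.
have c20 : 0 < c2 by exact: divr_gt0.
(* The halves make the target at most the mean of the two lower bounds, hence at most the larger
   one. *)
pose C := Num.min c1 c2 / 2.
have C0 : 0 < C by rewrite divr_gt0// lt_min c10.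
exists C => // x Ox; have [N [lN IxN]] := IN x Ox.
have g0 := powR_ge0 (delta x) gamma; set g := delta x `^ gamma in g0 *.
set L := `|ln (delta x)| in lN *.
have NL0 : 0 <= N%:R * ln 4 :> R by rewrite mulr_ge0// ltW.
have C1 : C <= c1 / 2 by rewrite ler_wpM2r// ge_min lexx.
have C2 : C <= c2 / 2 by rewrite ler_wpM2r// ge_min lexx orbT.
have u1 : C * (g * (1 + A)) <= (c * g) / 2.
  rewrite (le_trans (ler_wpM2r _ C1)) ?mulr_ge0 ?(ltW A10)//.
  by rewrite /c1 le_eqVlt; apply/orP; left; apply/eqP; field; rewrite gt_eqF.
have u2 : C * (g * (N%:R * ln 4)) <= (N%:R * k * g) / 2.
  rewrite (le_trans (ler_wpM2r _ C2)) ?mulr_ge0 ?(ltW l4)//.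
  rewrite /c2 le_eqVlt; apply/orP; left; apply/eqP.
  by field; rewrite gt_eqF.
have u3 : C * (g * (1 + L)) <= (c * g) / 2 + (N%:R * k * g) / 2.
  rewrite (le_trans _ (lerD u1 u2))// -mulrDr ler_wpM2l ?(ltW C0)// -mulrDr.
  by rewrite ler_wpM2l//; move: lN; lra.
have [h|h] := leP (c * g) (N%:R * k * g).
  apply: le_trans IxN; rewrite lee_fin (le_trans u3)//.
  by move: h; move: (c * g) (N%:R * k * g) => a1 a2; lra.
apply: le_trans (hc x Ox); rewrite lee_fin (le_trans u3)//.
by move: h; move: (c * g) (N%:R * k * g) => a1 a2; lra.
Qed.

(** Off the diagonal G is within a factor C of the model kernel, and the pole is a null set, so
    bounds for the model integral carry over; C (c^-1 + c') dominates both C / c and C c'. *)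
Lemma green_operator_asymp (G : 'rV[R]_d.+1 -> 'rV[R]_d.+1 -> R) (phi : 'rV[R]_d.+1 -> R) :
  green_kernel Omega s gamma G -> (forall x, 0 <= phi x) ->
  (exists2 C, 0 < C & forall x, Omega x -> ((C * phi x)%:E <= I x)%E) ->
  (exists2 C, 0 < C & forall x, Omega x -> (I x <= (C * phi x)%:E)%E) ->
  asymp Omega (green_operator Omega G (fun y => delta y `^ beta)) (fun x => (phi x)%:E).
Proof.
move=> [_ _ _ _ [_ [C C0 hG]]] phi0 [c c0 hc] [c' c'0 hc'].
pose Gd := green_operator Omega G (fun y => delta y `^ beta).
have GI x : Omega x -> (C^-1%:E * I x <= Gd x)%E /\ (Gd x <= C%:E * I x)%E.
  move=> Ox; apply: (@integral_asymp_off_point _ _ _ _ Omega _ _ x C) => //.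
  - exact: rV_set1_measurable.
  - exact: lebesgue_rV_set1.
  - exact: measurable_Omega.
  - apply: measurable_funTS; apply: measurable_funM.
      exact: measurable_green_bound.
    exact: (measurableT_comp (measurable_powR beta) (measurable_bdist bO nO oO)).
  - by move=> y _; exact: green_integrand_ge0.
  - by rewrite green_bound_diag// mul0r.
  - move=> y Oy yx; have [] := hG (x, y); first by split => //=; rewrite eq_sym.
    rewrite /= -!EFinM !lee_fin => h1 h2.
    by split; rewrite mulrA ler_wpM2r ?powR_ge0.
exists (C * (c^-1 + c')); first by rewrite mulr_gt0// addr_gt0 ?invr_gt0.
move=> x Ox; have [h1 h2] := GI x Ox; split.
  apply: le_trans h1; apply: (@le_trans _ _ (C^-1%:E * (c * phi x)%:E)%E).
    rewrite -!EFinM lee_fin invfM -mulrA ler_wpM2l ?invr_ge0 ?(ltW C0)//.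
    rewrite ler_wpM2r// -[leRHS]invrK lef_pV2 ?posrE ?invr_gt0 ?addr_gt0 ?invr_gt0//.
    by rewrite lerDl ltW.
  by rewrite lee_wpmul2l ?lee_fin ?invr_ge0 ?(ltW C0)// hc.
apply: (le_trans h2); apply: (@le_trans _ _ (C%:E * (c' * phi x)%:E)%E).
  by rewrite lee_wpmul2l ?lee_fin ?(ltW C0)// hc'.
rewrite -!EFinM lee_fin -[leRHS]mulrA ler_wpM2l ?(ltW C0)// ler_wpM2r//.
by rewrite lerDr invr_ge0 ltW.
Qed.

End asymptotics.

Theorem theorem3p4 (R : realType) (d : nat) (Omega : set 'rV[R]_d.+1)
  (s gamma beta : R) (G : 'rV[R]_d.+1 -> 'rV[R]_d.+1 -> R)
  (hOmega : bounded_C11_domain Omega)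
  (hG : green_kernel Omega s gamma G)
  (hbeta : beta + gamma > -1) :
  let delta := bdist Omega in
  let Gdelta := green_operator Omega G (fun y => delta y `^ beta) in
  [/\ weighted_L1 Omega gamma (fun x => delta x `^ beta),
      (beta < gamma - 2 * s ->
        asymp Omega Gdelta (fun x => (delta x `^ (beta + 2 * s))%:E)),
      (beta = gamma - 2 * s ->
        asymp Omega Gdelta
          (fun x => (delta x `^ gamma * (1 + `|ln (delta x)|))%:E)),
      (beta > gamma - 2 * s ->
        asymp Omega Gdelta (fun x => (delta x `^ gamma)%:E)) &
      (beta <= gamma - 2 * s -> gamma > s - 2^-1) /\
      (gamma <= s - 2^-1 ->
        asymp Omega Gdelta (fun x => (delta x `^ gamma)%:E))].
Proof.
move=> delta Gdelta.
have [/andP[s0 _] /andP[g0 _] s2 _ _] := hG.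
have gt_case : beta > gamma - 2 * s ->
    asymp Omega Gdelta (fun x => (delta x `^ gamma)%:E).
  move=> b; apply: (@green_operator_asymp _ _ _ s gamma) => //.
  - by move=> x; exact: powR_ge0.
  - exact: green_integral_ge_boundary.
  - exact: green_integral_le_gt.
split => //.
- exact: weighted_L1_bdist.
- move=> b; apply: (@green_operator_asymp _ _ _ s gamma) => //.
  + by move=> x; exact: powR_ge0.
  + exact: green_integral_ge_near.
  + exact: green_integral_le_lt.
- move=> b; apply: (@green_operator_asymp _ _ _ s gamma) => //.
  + by move=> x; rewrite mulr_ge0 ?powR_ge0// addr_ge0.
  + exact: green_integral_ge_eq.
  + exact: green_integral_le_eq.
(* If beta <= gamma - 2s then -1 < beta + gamma <= 2 gamma - 2s, that is gamma > s - 1/2; the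
   contrapositive leaves only the third regime. *)
- split => [b|g]; first by lra.
  by apply: gt_case; lra.
Qed.
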